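(* Let $\lambda\in SP(n)$ be a strict partition with $|\lambda|=r>1$. Then there exist real numbers $s_1,\ldots,s_r$ such that the intersection $$X_\lambda F_\bullet(0)\cap YF_\bullet(s_1)\cap\cdots\cap YF_\bullet(s_r)$$ in the Lagrangian Grassmannian $LG(n)$ is $0$-dimensional and has no real points.
   Context: $V$ is a complex vector space with basis $e_1,\ldots,e_{2n}$ and the nondegenerate alternating form $\langle\sum x_ie_i,\sum y_je_j\rangle=\sum_{i=1}^n(x_iy_{2n+1-i}-y_ix_{2n+1-i})$; the real structure is the one given by the basis. $LG(n)$ is the space of all Lagrangian (maximal isotropic) subspaces of $V$ (they have dimension $n$). An isotropic flag is a complete flag $F_\bullet$ of $V$ ($\dim F_i=i$) such that $F_n$ is Lagrangian and, for $i>n$, $F_i$ is the annihilator of $F_{2n-i}$. $SP(n)$ is the set of strict partitions: decreasing sequences $n\ge\lambda_1>\cdots>\lambda_l>0$ of integers (possibly empty), with $|\lambda|:=\lambda_1+\cdots+\lambda_l$. An isotropic flag $F_\bullet$ induces the Bruhat (Schubert cell) decomposition $LG(n)=\coprod_{\lambda\in SP(n)}X_\lambda^\circ F_\bullet$, where $X_\lambda^\circ F_\bullet$ consists of those $H\in LG(n)$ for which $\{j>n\mid H\cap F_j\ne H\cap F_{j-1}\}=\{n+\lambda_1,\ldots,n+\lambda_l\}$. The Schubert variety $X_\lambda F_\bullet$ is the closure of $X_\lambda^\circ F_\bullet$ and has dimension $|\lambda|$. The unique simple (codimension-1) Schubert variety is $YF_\bullet:=\{H\in LG(n)\mid H\cap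 F_n\ne\{0\}\}=X_{(n,n-1,\ldots,2)}F_\bullet$. Fix a real rational normal curve $\gamma:\mathbb{C}\to V$ (its coordinates form a basis of the space of real polynomials of degree at most $2n-1$) whose flags $F_\bullet(s)$ of osculating subspaces are isotropic, where $F_i(s)$ is the linear span of $\gamma(s),\gamma'(s),\ldots,\gamma^{(i-1)}(s)$. One such choice is $\gamma(s)=\left(1,s,\frac{s^2}{2},\ldots,\frac{s^n}{n!},-\frac{s^{n+1}}{(n+1)!},\frac{s^{n+2}}{(n+2)!},\ldots,(-1)^{n-1}\frac{s^{2n-1}}{(2n-1)!}\right)$. *)

(* Defs.v *)
From HB Require Import structures.
From mathcomp Require Import all_boot all_order all_algebra.
From mathcomp Require Import boolp classical_sets reals topology.
From mathcomp Require Import complex qpoly.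
From mathcomp Require Import (canonicals) mpoly.

Set Implicit Arguments.
Unset Strict Implicit.
Unset Printing Implicit Defensive.

Import Order.TTheory GRing.Theory Num.Theory.
Local Open Scope classical_set_scope.
Local Open Scope ring_scope.
Local Open Scope complex_scope.

(** * The symplectic space *)

Notation symV R n := 'rV[R[i]]_(n + n).

Section Symplectic.
Variables (R : realType) (n : nat).
Implicit Types (x y v : symV R n) (H K U : {vspace symV R n}).

(* [rev_ord] sends the 0-based index [i] to [2n-1-i], that is, the 1-based
   index [i] to [2n+1-i]. *)
Definition sympl x y : R[i] :=
  \sum_(i < n) (x 0 (lshift n i) * y 0 (rev_ord (lshift n i))
              - y 0 (lshift n i) * x 0 (rev_ord (lshift n i))).

Definition isotropic H : Prop :=
  forall x y, x \in H -> y \in H -> sympl x y = 0.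

Definition lagrangian H : Prop :=
  isotropic H /\ (forall K, isotropic K -> (H <= K)%VS -> K = H).

Definition annihilator U : set (symV R n) :=
  [set v | forall u, u \in U -> sympl u v = 0].

(* Only the values [F 0, ..., F (2n)] of [F] are used. *)
Definition isotropic_flag (F : nat -> {vspace symV R n}) : Prop :=
  [/\ forall i, (i <= n + n)%N -> \dim (F i) = i,
      forall i, (i < n + n)%N -> (F i <= F i.+1)%VS,
      lagrangian (F n)
    & forall i, (n < i <= n + n)%N ->
        [set v | v \in F i] = annihilator (F (n + n - i)%N)].

End Symplectic.

(** * The Lagrangian Grassmannian and its Zariski topology *)

Record LG (R : realType) (n : nat) := MkLG {
  lg_space :> {vspace symV R n};
  _ : `[< lagrangian lg_space >] }.

HB.instance Definition _ (R : realType) (n : nat) :=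
  [isSub for @lg_space R n].
HB.instance Definition _ (R : realType) (n : nat) :=
  [Choice of LG R n by <:].

Section Zariski.
Variables (R : realType) (n : nat).

Definition row_space (A : 'M[R[i]]_(n, n + n)) : {vspace symV R n} :=
  <<[seq row i A | i <- enum 'I_n]>>%VS.

(* The Grassmannian of [n]-planes is the quotient of the space of [n x 2n]
   matrices of rank [n] by the left action of [GL_n]; the Zariski topology of
   [LG] is the quotient of the Zariski topology on the matrices whose row
   space is Lagrangian (such matrices have rank [n]). *)
Definition zariski_closed (Z : set (LG R n)) : Prop :=
  exists P : set (mpoly.mpoly (n * (n + n)) R[i]),
  forall (A : 'M[R[i]]_(n, n + n)) (H : LG R n), row_space A = H ->
    Z H <-> (forall p, P p -> mpoly.meval (fun k => mxvec A 0 k) p = 0).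

Definition zariski_open (U : set (LG R n)) : Prop := zariski_closed (~` U).

Fact zariski_openT : zariski_open setT.
Proof.
exists [set (1 : mpoly.mpoly (n * (n + n)) R[i])] => A H _.
rewrite setCT; split=> // /(_ 1 erefl).
by rewrite rmorph1 => /eqP; rewrite oner_eq0.
Qed.

Fact zariski_openI : setI_closed zariski_open.
Proof.
move=> U W [P hP] [Q hQ].
exists [set f | exists p q, [/\ P p, Q q & f = p * q]] => A H hA.
rewrite setCI; split.
  move=> h f [p [q [Pp Qq ->]]]; rewrite rmorphM /=.
  case: h => h; first by rewrite ((hP A H hA).1 h p Pp) mul0r.
  by rewrite ((hQ A H hA).1 h q Qq) mulr0.
move=> h; have [?|nU] := pselect ((~` U) H); first by left.
right; apply/(hQ A H hA) => q Qq; apply: contrapT => q0; apply: nU.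
apply/(hP A H hA) => p Pp.
have /eqP := h (p * q) (ex_intro _ p (ex_intro _ q (And3 Pp Qq erefl))).
by rewrite rmorphM mulf_eq0 => /orP[/eqP //|/eqP].
Qed.

Fact zariski_open_bigU (I : Type) (f : I -> set (LG R n)) :
  (forall i, zariski_open (f i)) -> zariski_open (\bigcup_i f i).
Proof.
move=> /boolp.choice[P hP]; exists [set p | exists i, P i p] => A H hA; split.
  by move=> h p [i Pp]; apply: (hP i A H hA).1 Pp => fH; apply: h; exists i.
move=> h [i _ fH]; apply: (hP i A H hA).2 fH => p Pp.
by apply: h; exists i.
Qed.

HB.instance Definition _ := isOpenTopological.Build (LG R n)
  zariski_openT zariski_openI zariski_open_bigU.

End Zariski.

(** * Krull dimension of a subset, for the subspace topology *)

Section KrullDimension.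
Variable T : topologicalType.
Implicit Types X Z : set T.

Definition relatively_closed X Z : Prop :=
  exists2 W : set T, closed W & Z = X `&` W.

Definition irreducible Z : Prop :=
  Z !=set0 /\ forall W1 W2 : set T, closed W1 -> closed W2 ->
    Z `<=` W1 `|` W2 -> Z `<=` W1 \/ Z `<=` W2.

Definition has_irreducible_chain X (d : nat) : Prop :=
  exists Z : nat -> set T,
    (forall i, (i <= d)%N -> relatively_closed X (Z i) /\ irreducible (Z i)) /\
    (forall i, (i < d)%N -> Z i `<` Z i.+1).

(* In particular, a set of dimension [d] is not empty. *)
Definition has_dimension X (d : nat) : Prop :=
  has_irreducible_chain X d /\ ~ has_irreducible_chain X d.+1.

End KrullDimension.

(** * Schubert varieties *)

Definition strict_partition (n : nat) (lam : seq nat) : bool :=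
  sorted gtn lam && all (fun k => 0 < k <= n)%N lam.

Section Schubert.
Variables (R : realType) (n : nat).
Implicit Types (F : nat -> {vspace symV R n}) (lam : seq nat).

Definition schubert_cell F lam : set (LG R n) :=
  [set H : LG R n | forall j, (n < j <= n + n)%N ->
     ((H :&: F j)%VS != (H :&: F j.-1)%VS) = (j \in [seq (n + k)%N | k <- lam])].

Definition schubert_variety F lam : set (LG R n) :=
  closure (schubert_cell F lam).

Definition simple_schubert F : set (LG R n) :=
  [set H : LG R n | (H :&: F n)%VS != 0%VS].

(* [H] is equal to its complex conjugate. *)
Definition real_point (H : LG R n) : Prop :=
  forall v : symV R n,
    (map_mx (@conjc R) v \in lg_space H) = (v \in lg_space H).

End Schubert.

(** * Rational normal curves and their osculating flags *)

Section Curve.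
Variables (R : realType) (n : nat).

(* [{poly_(m) R}] is the space of polynomials of degree at most [m - 1]. *)
Definition rational_normal_curve (g : (n + n).-tuple {poly_(n + n) R}) : Prop :=
  basis_of fullv g.

Definition curve_derivative (g : (n + n).-tuple {poly_(n + n) R}) (k : nat)
    (s : R[i]) : symV R n :=
  \row_j (map_poly (real_complex R) (tnth g j : {poly R}))^`(k).[s].

Definition osculating_flag (g : (n + n).-tuple {poly_(n + n) R}) (s : R[i])
    (i : nat) : {vspace symV R n} :=
  <<[seq curve_derivative g k s | k <- iota 0 i]>>%VS.

End Curve.

(* Main.v *)
(* Send v to the polynomial f_v(x) = <v, gamma(x)>. This identifies V with the
   polynomials of degree less than 2n, F_i(s) with the multiples of
     (x-s)^(2n-i),
   and, up to a factor, the symplectic form with the alternating sum of the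
   products f^(k) g^(2n-1-k).

   For every choice of distinct nonzero reals s_i there is no real point. If f
     and
   g vanish to order n at the reals a and t, their pairing is up to sign the
   integral of f^(n) g^(n) from a to t. A relation between pairwise orthogonal
   vectors of this kind, attached to distinct reals, would annihilate the
     integral
   of the square of a piecewise polynomial function; hence such vectors are
   independent. A real H in the cell of lambda contains n - l independent
     vectors
   vanishing to order n at 0, where l < r is the number of parts, so it cannot
     lie
   on r further hyperplane sections.

   The s_k are chosen one after the other so that no point of X_mu with |mu| < k
   lies on the first k sections. The intersection then lies in the open cell, so
     it
   is a projective set that misses the hyperplane p_lambda = 0, and it is
     finite:
   by quantifier elimination a Pluecker ratio takes finitely or cofinitely many
   values, and it is bounded by compactness. If it were empty, the ratios of the
   r sections would define a finite-to-one map from the r-dimensional cell to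
   the affine space of dimension r - 1; strong minimality excludes this. *)

Require Import Defs.
From mathcomp Require Import all_boot all_order all_algebra all_field.
From mathcomp Require Import boolp classical_sets reals topology normedtype.
From mathcomp Require Import complex qpoly polyrcf.
From mathcomp Require Import (canonicals) mpoly.
From mathcomp Require Import zify ring lra.

Set Implicit Arguments.
Unset Strict Implicit.
Unset Printing Implicit Defensive.

Import Order.TTheory GRing.Theory Num.Theory.

Local Open Scope ring_scope.

(** * Polynomial functions *)

(** Finiteness and nonemptiness both rest on one fact about a single variable: a constructible
    subset of the line is finite or cofinite, with a bound uniform in the other variables. Krull
    dimension enters only at the end, where a finite nonempty set has to be given dimension 0. The
    closure of the cell is never described by exact equations. [in_schubert] is a coarser closed
    condition that compares weights only. It suffices because the points are chosen to exclude every
    smaller weight: the coarse set, the Schubert variety and the open cell meet the sections in the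
    same points. The strict inequality between the number of parts and r, on which the absence of
    real points depends, holds because the parts are distinct and their sum exceeds 1. *)

Section PolynomialFunctions.
Variables (K : comNzRingType) (T : Type).

(** Polynomiality is a predicate on functions so that the generators can vary: matrix entries for
    limits and closed sets, coordinates of an infinite tuple for quantifier elimination. Induction
    on it yields continuity, formal terms and multivariate polynomials alike. *)
Inductive polyfun (V : (T -> K) -> Prop) : (T -> K) -> Prop :=
| polyfun_gen v of V v : polyfun V v
| polyfun_cst c : polyfun V (fun=> c)
| polyfun_add f g of polyfun V f & polyfun V g : polyfun V (fun x => f x + g x)
| polyfun_mul f g of polyfun V f & polyfun V g : polyfun V (fun x => f x * g x).

Variable V : (T -> K) -> Prop.

Lemma polyfun_ext f g : f =1 g -> polyfun V f -> polyfun V g.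
Proof. by move=> /funext ->. Qed.

Lemma polyfun_opp f : polyfun V f -> polyfun V (fun x => - f x).
Proof.
move=> pf; apply: (@polyfun_ext (fun x => -1 * f x)) => [x|];
  first by rewrite mulN1r.
exact/polyfun_mul/pf/polyfun_cst.
Qed.

Lemma polyfun_sub f g :
  polyfun V f -> polyfun V g -> polyfun V (fun x => f x - g x).
Proof. by move=> pf pg; apply: polyfun_add => //; apply: polyfun_opp. Qed.

Lemma polyfun_sum I (r : seq I) (P : pred I) (F : I -> T -> K) :
  (forall i, polyfun V (F i)) -> polyfun V (fun x => \sum_(i <- r | P i) F i x).
Proof.
move=> pF; elim: r => [|i r IH].
  apply: polyfun_ext (polyfun_cst _ 0) => x; by rewrite big_nil.
case Pi: (P i); last by apply: polyfun_ext IH => x; rewrite big_cons Pi.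
by apply: polyfun_ext (polyfun_add (pF i) IH) => x; rewrite big_cons Pi.
Qed.

Lemma polyfun_prod I (r : seq I) (P : pred I) (F : I -> T -> K) :
  (forall i, polyfun V (F i)) -> polyfun V (fun x => \prod_(i <- r | P i) F i
    x).
Proof.
move=> pF; elim: r => [|i r IH].
  apply: polyfun_ext (polyfun_cst _ 1) => x; by rewrite big_nil.
case Pi: (P i); last by apply: polyfun_ext IH => x; rewrite big_cons Pi.
by apply: polyfun_ext (polyfun_mul (pF i) IH) => x; rewrite big_cons Pi.
Qed.

Lemma polyfun_det n (A : T -> 'M[K]_n) :
  (forall i j, polyfun V (fun x => A x i j)) -> polyfun V (fun x => \det (A x)).
Proof.
move=> pA; apply: polyfun_sum => s; apply: polyfun_mul;
  first exact: polyfun_cst.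
exact: polyfun_prod.
Qed.

Lemma polyfun_mulmx m n p (A : T -> 'M[K]_(m, n)) (B : T -> 'M[K]_(n, p)) :
  (forall i j, polyfun V (fun x => A x i j)) ->
  (forall i j, polyfun V (fun x => B x i j)) ->
  forall i j, polyfun V (fun x => (A x *m B x) i j).
Proof.
move=> pA pB i j.
apply: (@polyfun_ext (fun x => \sum_k A x i k * B x k j)).
  by move=> x; rewrite mxE.
by apply: polyfun_sum => k; apply: polyfun_mul.
Qed.

End PolynomialFunctions.

Lemma polyfun_comp (K : comNzRingType) (T S : Type) (V : (T -> K) -> Prop)
    (W : (S -> K) -> Prop) (u : S -> T) f :
  (forall v, V v -> polyfun W (fun x => v (u x))) ->
  polyfun V f -> polyfun W (fun x => f (u x)).
Proof.
move=> Vu; elim=> {f}[v /Vu //|c|f g _ pf _ pg|f g _ pf _ pg].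
- exact: polyfun_cst.
- exact: polyfun_add.
- exact: polyfun_mul.
Qed.

Definition coordinate (K : Type) (v : (nat -> K) -> K) : Prop :=
  exists i, v = (fun e => e i).

Lemma polyfun_coord (K : comNzRingType) i :
  polyfun (@coordinate K) (fun e => e i).
Proof. by apply: polyfun_gen; exists i. Qed.

(** * Constructible sets over an algebraically closed field *)

Section Constructible.
Variable K : closedFieldType.
Implicit Types (e : nat -> K) (P Q : (nat -> K) -> Prop) (i j : nat) (l : seq
  nat).

Definition upd e i x : nat -> K := fun j => if j == i then x else e j.

Lemma updC e i j x y : i != j -> upd (upd e i x) j y = upd (upd e j y) i x.
Proof.
move=> ij; apply/funext => k; rewrite /upd; case: (eqVneq k j) => [->|//].
by rewrite eq_sym (negPf ij).
Qed.

Inductive constr : ((nat -> K) -> Prop) -> Prop :=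
| constr_eq0 p of polyfun (@coordinate K) p : constr (fun e => p e = 0)
| constr_and P Q of constr P & constr Q : constr (fun e => P e /\ Q e)
| constr_not P of constr P : constr (fun e => ~ P e).

Lemma constr_ext P Q : (forall e, P e <-> Q e) -> constr P -> constr Q.
Proof. by move=> PQ; suff -> : P = Q by []; apply/funext => e;
  apply/propext. Qed.

Lemma constr_or P Q : constr P -> constr Q -> constr (fun e => P e \/ Q e).
Proof.
move=> cP cQ; apply: constr_ext (constr_not (constr_and (constr_not cP)
  (constr_not cQ))).
by move=> e; rewrite not_andE !notE.
Qed.

Lemma constr_cst (A : Prop) : constr (fun=> A).
Proof.
have [a|a] := EM A.
  by apply: constr_ext (constr_eq0 (polyfun_cst _ 0)) => e.
by apply: constr_ext (constr_not (constr_eq0 (polyfun_cst _ 0))) => e; split.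
Qed.

Lemma constr_eq p q :
  polyfun (@coordinate K) p -> polyfun (@coordinate K) q -> constr (fun e => p e
    = q e).
Proof.
move=> pp pq; apply: constr_ext (constr_eq0 (polyfun_sub pp pq)) => e.
by split=> [/subr0_eq|->] //; rewrite subrr.
Qed.

Lemma constr_all (I : eqType) (s : seq I) (P : I -> (nat -> K) -> Prop) :
  (forall k : I, constr (P k)) -> constr (fun e => forall k : I, k \in s -> P k
    e).
Proof.
move=> cP; elim: s => [|i s IH].
  by apply: constr_ext (constr_cst True) => e; split.
apply: constr_ext (constr_and (cP i) IH) => e; split=> [[Pi Ps] j|Ps].
  by rewrite inE => /orP[/eqP ->|/Ps].
by split=> [|j js]; apply: Ps; rewrite inE ?eqxx ?js ?orbT.
Qed.

Lemma constr_has (I : eqType) (s : seq I) (P : I -> (nat -> K) -> Prop) :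
  (forall k : I, constr (P k)) -> constr (fun e => exists2 k : I, k \in s & P k
    e).
Proof.
move=> cP; apply: constr_ext (constr_not (constr_all (P := fun k e => ~ P k e) s
  (fun k => constr_not (cP k)))).
move=> e; split=> [h|[i si Pi] h]; last exact: (h i).
by apply: contrapT => nh; apply: h => i si Pi; apply: nh; exists i.
Qed.

Lemma constr_subst P (u : (nat -> K) -> (nat -> K)) :
  (forall i, polyfun (@coordinate K) (fun e => u e i)) ->
  constr P -> constr (fun e => P (u e)).
Proof.
move=> pu; elim=> {P}[p pp|P Q _ cP _ cQ|P _ cP].
- by apply: constr_eq0; apply: polyfun_comp pp => v [i ->].
- exact: constr_and.
- exact: constr_not.
Qed.

Lemma constr_upd P i x : constr P -> constr (fun e => P (upd e i x)).
Proof.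
apply: constr_subst => j; rewrite /upd; case: eqP => _;
  first exact: polyfun_cst.
exact: polyfun_coord.
Qed.

Lemma polyfun_term p : polyfun (@coordinate K) p ->
  exists (t : GRing.term K) N, GRing.rterm t /\
    forall e M, (N <= M)%N -> GRing.eval (mkseq e M) t = p e.
Proof.
elim=> {p}[v [i ->]|c|p q _ [t [N [rt ht]]] _ [t' [N' [rt' ht']]]
  |p q _ [t [N [rt ht]]] _ [t' [N' [rt' ht']]]].
- by exists (GRing.Var _ i), i.+1; split=> // e M iM /=; rewrite nth_mkseq.
- by exists (GRing.Const c), 0%N.
- exists (GRing.Add t t'), (maxn N N'); split=> /= [|e M];
  first by rewrite rt rt'.
  by rewrite geq_max => /andP[/ht -> /ht' ->].
- exists (GRing.Mul t t'), (maxn N N'); split=> /= [|e M];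
  first by rewrite rt rt'.
  by rewrite geq_max => /andP[/ht -> /ht' ->].
Qed.

Lemma constr_formula P : constr P ->
  exists (f : GRing.formula K) N, GRing.rformula f /\
    forall e M, (N <= M)%N -> GRing.holds (mkseq e M) f <-> P e.
Proof.
elim=> {P}[p pp|P Q _ [f [N [rf hf]]] _ [g [N' [rg hg]]]|P _ [f [N [rf hf]]]].
- have [t [N [rt ht]]] := polyfun_term pp.
  exists (GRing.Equal t (GRing.Const 0)), N; split=> /= [|e M NM];
    first by rewrite rt.
  by rewrite ht.
- exists (GRing.And f g), (maxn N N'); split=> /= [|e M];
  first by rewrite rf rg.
  by rewrite geq_max => /andP[/hf h /hg h']; rewrite h h'.
- by exists (GRing.Not f), N; split=> //= e M /hf h; rewrite h.
Qed.

Lemma term_polyfun (t : GRing.term K) M :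
  GRing.rterm t -> polyfun (@coordinate K) (fun e => GRing.eval (mkseq e M) t).
Proof.
elim: t => //=.
- move=> i _; have [iM|Mi] := ltnP i M.
    by apply: polyfun_ext (@polyfun_coord K i) => e; rewrite nth_mkseq.
  by apply: polyfun_ext (polyfun_cst _ 0) => e; rewrite nth_default ?size_mkseq.
- by move=> c _; apply: polyfun_cst.
- by move=> m _; apply: polyfun_cst.
- by move=> t IHt u IHu /andP[/IHt pt /IHu pu]; apply: polyfun_add.
- by move=> t IHt /IHt; apply: polyfun_opp.
- move=> t IHt m /IHt pt.
  apply: polyfun_ext (polyfun_mul (polyfun_cst _ m%:R) pt) => e.
  by rewrite mulr_natl.
- by move=> t IHt u IHu /andP[/IHt pt /IHu pu]; apply: polyfun_mul.
- move=> t IHt m /IHt pt.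
  by apply: polyfun_ext (polyfun_prod (iota 0 m) xpredT (fun=> pt)) => e;
    rewrite big_const_seq count_predT size_iota iter_mulr_1.
Qed.

Lemma qf_formula_constr (f : GRing.formula K) M :
  GRing.qf_form f -> GRing.rformula f -> constr (fun e => GRing.qf_eval (mkseq e
    M) f).
Proof.
elim: f => //=.
- by move=> b _ _; apply: constr_cst.
- move=> t u _ /andP[rt ru].
  apply: constr_ext (constr_eq (term_polyfun M rt) (term_polyfun M ru)) => e.
  by split=> /eqP.
- move=> f IHf g IHg /andP[qf qg] /andP[rf rg].
  apply: constr_ext (constr_and (IHf qf rf) (IHg qg rg)) => e.
  by split=> [[-> ->]|/andP].
- move=> f IHf g IHg /andP[qf qg] /andP[rf rg].
  apply: constr_ext (constr_or (IHf qf rf) (IHg qg rg)) => e.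
  by split=> /orP.
- move=> f IHf g IHg /andP[qf qg] /andP[rf rg].
  apply: constr_ext (constr_or (constr_not (IHf qf rf)) (IHg qg rg)) => e.
  by rewrite implybE; split=> [[/negP ->|->]|/orP[/negP|]] //;
    [rewrite orbT|left|right].
- move=> f IHf qf rf; apply: constr_ext (constr_not (IHf qf rf)) => e.
  by split=> /negP.
Qed.

(** Chevalley's theorem, by quantifier elimination over an algebraically closed field. *)
Lemma constr_ex P i : constr P -> constr (fun e => exists x, P (upd e i x)).
Proof.
move=> /constr_formula[f [N [rf hf]]].
(* The truncated tuple must also contain the bound variable, so that updating it does not lengthen
   the sequence. *)
pose M := maxn N i.+1.
have rE : GRing.rformula (GRing.Exists i f) by [].
pose elim := GRing.quantifier_elim (@ClosedFieldQE.ex_elim K).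
have /andP[qE rqE] := GRing.quantifier_elim_wf (@ClosedFieldQE.wf_ex_elim K) rE.
apply: constr_ext (qf_formula_constr M qE rqE) => e.
have elimP := GRing.quantifier_elim_rformP (@ClosedFieldQE.wf_ex_elim K)
  (ClosedFieldQE.holds_ex_elim (@solve_monicpoly K)) (mkseq e M) rE.
suff upd_mkseq x : set_nth 0 (mkseq e M) i x = mkseq (upd e i x) M.
  have hfM x : GRing.holds (mkseq (upd e i x) M) f <-> P (upd e i x).
    by apply: hf; rewrite leq_maxl.
  split=> [/elimP[x]|[x Px]]; first by rewrite upd_mkseq => /(hfM x); exists x.
  by apply/elimP; exists x; rewrite upd_mkseq; apply/(hfM x).
have iM : (i < M)%N by rewrite leq_maxr.
apply: (@eq_from_nth _ 0); rewrite size_set_nth !size_mkseq;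
  first exact/maxn_idPr.
move=> j; rewrite (maxn_idPr iM) => jM.
by rewrite nth_set_nth /= !nth_mkseq.
Qed.

(** ** Strong minimality *)

Definition finite_set (S : K -> Prop) := exists s : seq K, forall x, S x -> x
  \in s.

Definition cofin (S : K -> Prop) := finite_set (fun x => ~ S x).

Lemma polyfun_horner p i : polyfun (@coordinate K) p ->
  exists D, forall e, exists2 q : {poly K}, (size q <= D)%N &
    forall x, p (upd e i x) = q.[x].
Proof.
elim=> {p}[v [j ->]|c|p q _ [D hD] _ [D' hD']|p q _ [D hD] _ [D' hD']].
- exists 2 => e; have [ji|ji] := eqVneq j i.
    by exists 'X => [|x]; rewrite ?size_polyX // hornerX /upd ji eqxx.
  exists (e j)%:P => [|x]; first by rewrite (leq_trans (size_polyC_leq1 _)).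
  by rewrite hornerC /upd (negPf ji).
- exists 1%N => e; exists c%:P => [|x]; last by rewrite hornerC.
  exact: size_polyC_leq1.
- exists (maxn D D') => e; have [[u su hu] [v sv hv]] := (hD e, hD' e).
  exists (u + v) => [|x]; last by rewrite hornerD hu hv.
  by rewrite (leq_trans (size_polyD _ _)) // geq_max !leq_max su sv orbT.
- exists (D + D')%N => e; have [[u su hu] [v sv hv]] := (hD e, hD' e).
  exists (u * v) => [|x]; last by rewrite hornerM hu hv.
  by rewrite (leq_trans (size_polyMleq _ _)) // (leq_trans (leq_pred _)) //
    leq_add.
Qed.

(** As a polynomial in the variable [i], an equation has degree bounded independently of the other
    variables: it is identically zero or has boundedly many roots. The bound survives conjunction
    and negation. *)
Lemma strong_minimality P i : constr P -> exists M, forall e,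
  exists2 s : seq K, (size s <= M)%N &
    (forall x, P (upd e i x) -> x \in s) \/ (forall x, ~ P (upd e i x) -> x \in
      s).
Proof.
elim=> {P}[p /(polyfun_horner i)[D hD]|P Q _ [M hM] _ [N hN]|P _ [M hM]].
- exists D => e; have [q sq hq] := hD e.
  have [q0|q0] := eqVneq q 0.
    by exists [::] => //; right=> x; rewrite hq q0 horner0.
  have [s qE] := closed_field_poly_normal q.
  exists s.
    rewrite -ltnS (leq_trans _ (leqW sq)) // qE size_scale ?lead_coef_eq0 //.
    by rewrite size_prod_XsubC.
  left=> x; rewrite hq => /eqP; rewrite qE hornerZ mulf_eq0 lead_coef_eq0 (negPf
    q0).
  by move=> xs; rewrite -root_prod_XsubC.
- exists (M + N)%N => e; have [[s ss hs] [t st ht]] := (hM e, hN e).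
  exists (s ++ t); first by rewrite size_cat leq_add.
  case: hs => hs; first by left=> x [/hs xs _]; rewrite mem_cat xs.
  case: ht => ht; first by left=> x [_ /ht xt]; rewrite mem_cat xt orbT.
  right=> x /not_andP[/hs|/ht] h; by rewrite mem_cat h ?orbT.
- exists M => e; have [s ss hs] := hM e; exists s => //.
  case: hs => hs; [right|by left].
  by move=> x nnP; apply: hs; apply: contrapT.
Qed.

Lemma fresh (s : seq K) M : exists2 t : seq K, uniq t & size t = M /\ forall x,
  x \in t -> x \notin s.
Proof.
elim: M => [|M [t ut [st ht]]]; first by exists [::].
have /closed_nonrootP[q hq] : \prod_(x <- s ++ t) ('X - x%:P) != 0.
  exact/monic_neq0/monic_prod_XsubC.
rewrite root_prod_XsubC mem_cat negb_or in hq; case/andP: hq => hs hq.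
exists (q :: t); first by rewrite /= hq.
split=> [|x]; first by rewrite /= st.
by rewrite inE => /orP[/eqP ->|/ht].
Qed.

Lemma not_finite_cofin (S : K -> Prop) : finite_set S -> cofin S -> False.
Proof.
move=> [s hs] [t ht]; have [u _ [su hu]] := fresh (s ++ t) 1;
  case: u su hu => // x u _ hu.
have := hu x (mem_head x u); rewrite mem_cat negb_or => /andP[/negP xs /negP
  xt].
by case: (EM (S x)) => [/hs|/ht].
Qed.

Lemma cofin_and (S S' : K -> Prop) : cofin S -> cofin S' -> cofin (fun x => S x
  /\ S' x).
Proof.
move=> [s hs] [t ht]; exists (s ++ t) => x /not_andP[/hs|/ht] h;
  by rewrite mem_cat h ?orbT.
Qed.

Lemma cofin_sub (S S' : K -> Prop) : (forall x, S x -> S' x) -> cofin S -> cofin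
  S'.
Proof. by move=> SS [s hs]; exists s => x nS; apply: hs => /SS. Qed.

Lemma cofinT (S : K -> Prop) : (forall x, S x) -> cofin S.
Proof. by move=> hS; exists [::]. Qed.

Lemma cofin_ex (S : K -> Prop) : cofin S -> exists x, S x.
Proof.
move=> cS; apply: contrapT => nS; apply: (not_finite_cofin _ cS).
by exists [::] => x Sx; case: nS; exists x.
Qed.

Lemma constr_dichotomy P i e : constr P ->
  finite_set (fun x => P (upd e i x)) \/ cofin (fun x => P (upd e i x)).
Proof.
by case/(strong_minimality i) => M /(_ e)[s _ [hs|hs]]; [left|right]; exists s.
Qed.

Lemma constr_finite_bound P i : constr P -> exists M, forall e,
  finite_set (fun x => P (upd e i x)) ->
  forall t : seq K, uniq t -> (forall x, x \in t -> P (upd e i x)) -> (size t <=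
    M)%N.
Proof.
case/(strong_minimality i) => M hM; exists M => e fP t ut tP.
have [s ss [hs|hs]] := hM e; last first.
  by case: (not_finite_cofin fP); exists s.
by rewrite (leq_trans _ ss) // uniq_leq_size // => x /tP /hs.
Qed.

(* With [M] as in [strong_minimality] and [2M+1] fixed test values, [P] is
   cofinite in the variable [i] iff it holds at more than [M] test values. *)
Lemma constr_cofin P i : constr P -> constr (fun e => cofin (fun x => P (upd e i
  x))).
Proof.
move=> cP; have [M hM] := strong_minimality i cP.
have [t ut [st _]] := fresh [::] (M + M.+1).
pose v (k : 'I_(size t)) := nth 0 t k.
have v_inj : injective v.
  by move=> k k' /eqP; rewrite nth_uniq // => /eqP/val_inj.
have card_v (A : {set 'I_(size t)}) (s : seq K) :
    (forall k, k \in A -> v k \in s) -> (#|A| <= size s)%N.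
  move=> As; rewrite cardE -(size_map v) uniq_leq_size ?map_inj_uniq ?enum_uniq
    //.
  by move=> x /mapP[k]; rewrite mem_enum => /As ? ->.
apply: constr_ext (constr_has (enum {set 'I_(size t)})
  (P := fun (A : {set 'I_(size t)}) e => (M < #|A|)%N /\
    forall k, k \in enum A -> P (upd e i (v k)))
  (fun A => constr_and (constr_cst (M < #|A|)%N)
    (constr_all (P := fun k e => P (upd e i (v k))) (enum A) (fun k =>
      constr_upd i (v k) cP)))) => e.
have [s ss hs] := hM e; split=> [[A _ [MA hA]]|cf].
  case: hs => hs; last by exists s.
  suff: (#|A| <= M)%N by rewrite leqNgt MA.
  by rewrite (leq_trans _ ss) // card_v // => k kA; apply: hs; apply: hA;
    rewrite mem_enum.
pose A := [set k | v k \notin s]; exists A; first by rewrite mem_enum.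
case: hs => hs; first by case: (not_finite_cofin _ cf); exists s.
split=> [|k]; last first.
  by rewrite mem_enum inE => ks; apply: contrapT => /hs; apply/negP.
have cardE : (#|A| + #|~: A|)%N = size t by rewrite cardsC card_ord.
have : (#|~: A| <= M)%N.
  by rewrite (leq_trans _ ss) // card_v // => k; rewrite !inE negbK.
by move: #|A| #|~: A| cardE => a b; lia.
Qed.

(** ** Finite-to-one correspondences *)

Definition agree_off l e e' := forall j, j \notin l -> e j = e' j.

Lemma agree_offC l e e' : agree_off l e e' -> agree_off l e' e.
Proof. by move=> h j /h. Qed.

Lemma agree_off_trans l e e' e'' :
  agree_off l e e' -> agree_off l e' e'' -> agree_off l e e''.
Proof. by move=> h h' j jl; rewrite h // h'. Qed.

Lemma agree_off_sub l l' e e' :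
  {subset l <= l'} -> agree_off l e e' -> agree_off l' e e'.
Proof. by move=> ll' h j jl'; apply: h; apply: contra jl' => /ll'. Qed.

Lemma agree_off_upd l e i x : i \in l -> agree_off l e (upd e i x).
Proof. by move=> il j jl; rewrite /upd; case: eqP jl => // ->; rewrite il. Qed.

(** An iterated quantifier: for almost all values of the first variable, then of the second, and so
    on. For constructible sets it stands in for density in the affine space of the variables [l]. *)
Fixpoint generic l P e : Prop :=
  if l is i :: l' then cofin (fun x => generic l' P (upd e i x)) else P e.

Definition exl l P e : Prop := exists2 e', agree_off l e e' & P e'.

Lemma constr_generic l P : constr P -> constr (generic l P).
Proof. by move=> cP; elim: l => //= i l; apply: constr_cofin. Qed.

Lemma exl_cons i l P e : exl (i :: l) P e <-> exists x, exl l P (upd e i x).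
Proof.
split=> [[e' ee' Pe']|[x [e' ee' Pe']]].
  exists (e' i); exists e' => // j jl; rewrite /upd;
    case: eqP => [->//|/eqP ji].
  by apply: ee'; rewrite inE negb_or ji.
exists e' => // j; rewrite inE negb_or => /andP[ji jl].
by rewrite -ee' // /upd (negPf ji).
Qed.

Lemma constr_exl l P : constr P -> constr (exl l P).
Proof.
move=> cP; elim: l => [|i l IH].
  apply: constr_ext cP => e; split=> [Pe|[e' ee' Pe']]; first by exists e.
  by rewrite (_ : e = e') //; apply/funext => j; apply: ee'.
by apply: constr_ext (constr_ex i IH) => e; rewrite exl_cons.
Qed.

Lemma generic_mono l P Q e :
  (forall e', agree_off l e e' -> P e' -> Q e') -> generic l P e -> generic l Q
    e.
Proof.
elim: l e => [|i l IH] e PQ /=; first exact: PQ.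
apply: cofin_sub => x; apply: IH => e' ee'; apply: PQ.
apply: agree_off_trans (agree_off_upd _ _ (mem_head _ _)) _.
by apply: agree_off_sub ee' => j; rewrite inE orbC => ->.
Qed.

Lemma generic_and l P Q e :
  generic l P e -> generic l Q e -> generic l (fun e => P e /\ Q e) e.
Proof.
elim: l e => [|i l IH] e //= GP GQ.
by apply: cofin_sub (cofin_and GP GQ) => x [? ?]; apply: IH.
Qed.

Lemma generic_all (I : eqType) (s : seq I) (P : I -> (nat -> K) -> Prop) l e :
  (forall k, k \in s -> generic l (P k) e) ->
  generic l (fun e => forall k, k \in s -> P k e) e.
Proof.
elim: s => [_|k s IH hs].
  by elim: l e => [|i l IH] e //=; apply: cofinT.
have Gk := hs k (mem_head _ _).
have Gs : generic l (fun e => forall k, k \in s -> P k e) e.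
  by apply: IH => k' k's; apply: hs; rewrite inE k's orbT.
apply: generic_mono (generic_and Gk Gs) => e' _ [Pk Ps] k'.
by rewrite inE => /orP[/eqP ->|/Ps].
Qed.

Lemma generic_dichotomy l P e :
  constr P -> generic l P e \/ generic l (fun e => ~ P e) e.
Proof.
move=> cP; elim: l e => [|i l IH] e /=; first exact: EM.
have [[s hs]|] := constr_dichotomy i e (constr_generic l cP); last by left.
right; exists s => x nG; apply: hs.
by have [|/nG] := IH (upd e i x).
Qed.

Lemma generic_ex l P e : generic l P e -> exl l P e.
Proof.
elim: l e => [|i l IH] e /=; first by exists e.
by move=> /cofin_ex[x /IH Ex]; apply/exl_cons; exists x.
Qed.

Lemma generic_cat l l' P e : generic (l ++ l') P e = generic l (generic l' P) e.
Proof.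
elim: l e => //= i l IH e; congr cofin.
by apply/funext => x; rewrite IH.
Qed.

Lemma generic_upd l P e i x : i \notin l ->
  generic l P (upd e i x) <-> generic l (fun e => P (upd e i x)) e.
Proof.
elim: l e => //= j l IH e; rewrite inE negb_or => /andP[ij il].
by split; apply: cofin_sub => y; rewrite updC // => /IH; apply.
Qed.

Lemma generic_or l P Q e : constr P ->
  generic l (fun e => P e \/ Q e) e -> generic l P e \/ generic l Q e.
Proof.
move=> cP GPQ; have [|GnP] := generic_dichotomy l e cP; [by left|right].
by apply: generic_mono (generic_and GPQ GnP) => e' _ [[]].
Qed.

Definition finite_fibres lx ly P e := forall e', agree_off (lx ++ ly) e e' ->
  exists s : seq K, forall e'', agree_off lx e' e'' -> P e'' ->
    forall i, i \in lx -> e'' i \in s.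

(** [P] is a correspondence between two affine spaces of equal dimension. If it is dominant over the
    first and has finite fibres over the second, it is dominant over the second. This and [no_drop]
    are proved by an alternating induction. *)
Definition dominance m := forall lx ly P e, uniq (lx ++ ly) ->
  size lx = m -> size ly = m -> constr P -> finite_fibres lx ly P e ->
  generic lx (exl ly P) e -> generic ly (exl lx P) e.

Definition no_drop m := forall lx ly P e, uniq (lx ++ ly) ->
  size lx = m.+1 -> size ly = m -> constr P -> finite_fibres lx ly P e ->
  ~ generic lx (exl ly P) e.

(** Fix the first variable of [lx] at more values than a finite fibre can contain. Each slice
    dominates the space of [ly], so one point of that space lies in all the images, and its fibre is
    too large. *)
Lemma dominance_no_drop m : dominance m -> no_drop m.
Proof.
move=> Dm [//|i lx] ly P e /= /andP[i_l u_l] [sx] sy cP fP [s hs].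
have [ilx ily] : i \notin lx /\ i \notin ly.
  by move: i_l; rewrite mem_cat negb_or => /andP.
have [M hM] := constr_finite_bound i (constr_exl lx cP).
have [t ut [st ht]] := fresh s M.+1.
have Gt x : x \in t -> generic ly (fun e => exl lx P (upd e i x)) e.
  move=> xt; apply/generic_upd => //; apply: Dm => //; last first.
    by apply: contrapT => /hs; apply/negP; apply: ht.
  move=> e' ee'; have [|s' hs'] := fP e'.
    apply: agree_off_trans (agree_off_upd _ _ (mem_head _ _)) _.
    by apply: agree_off_sub ee' => j; rewrite inE orbC => ->.
  exists s' => e'' e'e'' Pe'' j jlx; apply: hs' => //;
    last by rewrite inE jlx orbT.
  by apply: agree_off_sub e'e'' => k; rewrite inE orbC => ->.
have [e' ee' He'] := generic_ex (generic_all Gt).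
suff /hM/(_ t ut He') : finite_set (fun x => exl lx P (upd e' i x)).
  by rewrite st ltnn.
have [|s' hs'] := fP e'.
  by apply: agree_off_sub ee' => j jly; rewrite inE mem_cat jly !orbT.
exists s' => x [e'' e'e'' Pe''].
have xE : e'' i = x by rewrite -e'e'' // /upd eqxx.
rewrite -xE; apply: hs' => //; last exact: mem_head.
move=> j; rewrite inE negb_or => /andP[ji jlx].
by rewrite -e'e'' // /upd (negPf ji).
Qed.

(** If the image were not dense, some variable [j] of [ly] would be algebraic over the others on it.
    Deleting [j] keeps the fibres finite and leaves one variable too few, against [no_drop]. *)
Lemma no_drop_dominance m : (forall k, m = k.+1 -> no_drop k) -> dominance m.
Proof.
move=> Nm lx ly P e uxy sx sy cP fP GP.
have [//|GnP] := generic_dichotomy ly e (constr_exl lx cP); exfalso.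
have [ux [xy uy]] : uniq lx /\ (forall j, j \in ly -> j \notin lx) /\ uniq ly.
  move: uxy; rewrite cat_uniq => /and3P[? /hasPn ? ?]; by split.
(* [E] holds on enough of [P] to keep it dominant over [lx], does not depend on [l2], and is
   generically false in [l1]. The descent moves the last variable of [l1] to [l2]; at the end [E] is
   false outright. *)
suff descent l1 l2 E : ly = l1 ++ l2 -> constr E ->
    (forall e e', agree_off (lx ++ l2) e e' -> E e -> E e') ->
    generic l1 (fun e => ~ E e) e ->
    generic lx (exl ly (fun e => P e /\ E e)) e -> False.
  apply: (descent ly [::] (exl lx P)) => //; rewrite ?cats0 //.
  - exact: constr_exl.
  - move=> e1 e2 e12 [e3 e13 Pe3]; exists e3 => //.
    exact: agree_off_trans (agree_offC e12) e13.
  - apply: generic_mono GP => e1 _ [e2 e12 Pe2]; exists e2 => //.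
    by split=> //; exists e2.
elim/last_ind: l1 l2 E => [|l1 j IH] l2 E lyE cE invE /= GnE GPE.
  have [e1 ee1 [e2 e12 [Pe2 Ee2]]] := generic_ex GPE.
  apply: GnE; apply: invE Ee2; apply: agree_offC; apply: agree_off_trans.
    by apply: agree_off_sub ee1 => k; rewrite mem_cat => ->.
  by apply: agree_off_sub e12 => k; rewrite mem_cat lyE /= orbC => ->.
pose E' e := cofin (fun x => E (upd e j x)).
have cE' : constr E' by exact: constr_cofin.
have lyE' : ly = l1 ++ j :: l2 by rewrite lyE cat_rcons.
have jly : j \in ly by rewrite lyE' mem_cat mem_head orbT.
have jlx : j \notin lx by exact: xy.
have invE' e1 e2 : agree_off (lx ++ j :: l2) e1 e2 -> E' e1 -> E' e2.
  move=> e12; apply: cofin_sub => x; apply: invE => k kl; rewrite /upd.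
  case: eqP => // /eqP kj; apply: e12.
  by move: kl; rewrite !mem_cat inE !negb_or kj.
pose Q e := P e /\ E e /\ ~ E' e.
have cQ : constr Q by do 2!apply: constr_and => //; exact: constr_not.
(* Either [E'] can replace [E] and the descent continues, or [E] leaves finitely many values for the
   variable [j]. *)
have : generic lx (exl ly (fun e => P e /\ E' e)) e \/ generic lx (exl ly Q) e.
  apply: generic_or; first exact/constr_exl/constr_and.
  apply: generic_mono GPE => e1 _ [e2 e12 [Pe2 Ee2]].
  by have [E'e2|nE'e2] := EM (E' e2); [left|right]; exists e2.
case=> [GPE'|GQ].
  apply: (IH (j :: l2) E') => //.
  move: GnE; rewrite -cats1 generic_cat; apply: generic_mono => e1 _ /= nE cfE.
  by have [x []] := cofin_ex (cofin_and nE cfE).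
pose ly' := l1 ++ l2.
have syS : m = (size ly').+1 by rewrite -sy lyE' !size_cat /= addnS.
have sub_ly : {subset ly' <= ly}.
  by move=> k; rewrite lyE' !mem_cat inE => /orP[->|->] //; rewrite !orbT.
have ly_cases k : k \in ly -> k != j -> k \in ly'.
  by rewrite lyE' !mem_cat inE => /or3P[->|/eqP ->|->] //;
    rewrite ?eqxx // orbT.
have u_ly' : uniq (lx ++ ly').
  rewrite cat_uniq ux /=; apply/andP; split; first by apply/hasPn => k /sub_ly
    /xy.
  move: uy; rewrite lyE' !cat_uniq /= => /and3P[-> hn /andP[_ ->]];
    rewrite andbT /=.
  by move: hn; rewrite negb_or => /andP[].
apply: (Nm _ syS lx ly' (exl [:: j] Q) e u_ly' _ (erefl _));
  first by rewrite sx syS.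
- exact: constr_exl.
- move=> e1 ee1.
  have agr_upd x : agree_off (lx ++ ly) e (upd e1 j x).
    move=> k; rewrite mem_cat negb_or => /andP[klx kly].
    rewrite /upd; case: eqP kly jly => [-> /negPf ->//|_ kly _].
    apply: ee1; rewrite mem_cat negb_or klx.
    by apply: contra kly => /sub_ly.
  have [[sE hsE]|cfE] := constr_dichotomy j e1 cE; last first.
    exists [::] => e2 e12 [e3 e23 [_ [_ []]]].
    apply: invE' cfE => k; rewrite mem_cat inE !negb_or => /and3P[klx kj _].
    by rewrite e12 // e23 // inE.
  have /boolp.choice[f hf] := fun x => fP _ (agr_upd x).
  exists (flatten [seq f x | x <- sE]) => e2 e12 [e3 e23 [Pe3 [Ee3 _]]] i ilx.
  have e13 : agree_off lx (upd e1 j (e3 j)) e3.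
    move=> k klx; rewrite /upd; case: eqP => [->//|/eqP kj].
    by rewrite e12 // e23 // inE.
  apply/flatten_mapP; exists (e3 j).
    apply: hsE; apply: invE Ee3; apply: agree_offC.
    by apply: agree_off_sub e13 => k; rewrite mem_cat => ->.
  rewrite e23; first exact: hf.
  by rewrite inE; apply: contraNneq jlx => <-.
- apply: generic_mono GQ => e1 _ [e2 e12 Qe2].
  exists (upd e2 j (e1 j)) => [k kly'|].
    rewrite /upd; case: eqP => [->//|/eqP kj]; apply: e12.
    by apply/negP => /ly_cases /(_ kj); apply/negP.
  exists e2 => // k; rewrite inE => kj.
  by rewrite /upd (negPf kj).
Qed.

Lemma no_dropP m : no_drop m.
Proof.
elim: m => [|m IH]; apply: dominance_no_drop; apply: no_drop_dominance => // k.
by case=> <-.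
Qed.

End Constructible.

(** * Limits of polynomial functions along an ultrafilter *)

Section UltraLimit.
Import numFieldNormedType.Exports.
Local Open Scope classical_set_scope.

Lemma cvg_polyfun (K : numFieldType) (I T : Type) (U : set_system I) (V : (T ->
  K) -> Prop)
    (x : I -> T) (a : T) (f : T -> K) : ProperFilter U ->
  (forall v, V v -> v (x k) @[k --> U] --> v a) ->
  polyfun V f -> f (x k) @[k --> U] --> f a.
Proof.
move=> FU hV; elim=> {f}[v /hV //|c|f g _ hf _ hg|f g _ hf _ hg].
- exact: cvg_cst.
- exact: (cvgD hf hg).
- exact: (cvgM hf hg).
Qed.

Lemma ultra_bounded_real (R : realType) (U : set_system nat) (x : nat -> R) :
  UltraFilter U -> (forall k, `|x k| <= 1) ->
  exists a, forall e, 0 < e -> U [set k | `|a - x k| < e].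
Proof.
move=> uU hx; have FU : ProperFilter U by exact: ultra_proper.
have [|a [_ cla]] := @segment_compact R (-1) 1 (x @ U) (fmap_proper_filter _ _).
  by apply: (@filterS _ U _ setT) => [k _|]; [rewrite /= in_itv /= -ler_norml |
    exact: filterT].
exists a => e e0; pose A := [set k | `|a - x k| < e].
have [//|UnA] := in_ultra_setVsetC A uU.
have UxA : U (x @^-1` (x @` (~` A))) by apply: filterS UnA => k nk; exists k.
have [y [[k nk <-] xk]] := cla _ (ball a e) UxA (nbhsx_ballx a e e0).
by case: nk.
Qed.

Lemma ultra_bounded_complex (R : realType) (U : set_system nat) (x : nat ->
  R[i]) :
  UltraFilter U -> (forall k, `|x k| <= 1) ->
  exists a, forall e, 0 < e -> U [set k | `|a - x k| < e].
Proof.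
move=> uU hx; have FU : ProperFilter U by exact: ultra_proper.
have [|a ha] := @ultra_bounded_real R U (fun k => complex.Re (x k)) uU.
  by move=> k; rewrite -lecR (le_trans (normc_ge_Re _)) // hx.
have [|b hb] := @ultra_bounded_real R U (fun k => complex.Im (x k)) uU.
  by move=> k; rewrite -lecR (le_trans _ (hx k)) // normc_def lecR -sqrtr_sqr
    ler_wsqrtr // lerDr sqr_ge0.
exists (a +i* b)%C => e e0.
have eE : e = (complex.Re e)%:C%C.
  by rewrite RRe_real // gtr0_real.
have e1 : 0 < complex.Re e / 2 by rewrite divr_gt0 // -ltcR -eE.
apply: filterS (filterI (ha _ e1) (hb _ e1)) => k [/= h1 h2].
rewrite [x k]complexE; set p := complex.Re _; set q := complex.Im _.
have -> : (a +i* b)%C - (p%:C + 'i * q%:C)%C = (a - p)%:C%C + 'i%C * (b -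
  q)%:C%C.
  by rewrite [(a +i* b)%C]complexE /= !rmorphB /= mulrBr opprD addrACA.
rewrite (le_lt_trans (ler_normD _ _)) // normrM.
rewrite !normc_def /= expr0n expr1n add0r addr0 sqrtr1 mul1r !addr0 !sqrtr_sqr.
by rewrite -rmorphD eE ltcR; lra.
Qed.

Lemma invn_lt (R : realType) (e : R[i]) :
  0 < e -> exists N, forall k, (N <= k)%N -> k.+1%:R^-1 < e.
Proof.
move=> e0; have eE : e = (complex.Re e)%:C%C by rewrite RRe_real // gtr0_real.
have r0 : 0 < complex.Re e by rewrite -ltcR -eE.
exists (Num.bound (complex.Re e)^-1) => k Nk.
have -> : k.+1%:R^-1 = (k.+1%:R^-1)%:C%C :> R[i] by rewrite fmorphV rmorph_nat.
rewrite eE ltcR invf_plt ?posrE ?ltr0Sn //.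
have r0' : 0 <= (complex.Re e)^-1 by rewrite invr_ge0 ltW.
by rewrite (lt_le_trans (archi_boundP r0')) // ler_nat leqW.
Qed.

Definition mxentry (K : Type) m n (v : 'M[K]_(m, n) -> K) : Prop :=
  exists i j, v = (fun A => A i j).

Lemma polyfun_mxentry (K : comNzRingType) m n i j :
  polyfun (@mxentry K m n) (fun A => A i j).
Proof. by apply: polyfun_gen; exists i, j. Qed.

(* The entries converge along an ultrafilter, so the limit satisfies every
   polynomial equation that the sequence satisfies asymptotically. *)
Lemma bounded_mx_limit (R : realType) m n (x : nat -> 'M[R[i]]_(m, n)) :
  (forall k i j, `|x k i j| <= 1) ->
  exists a, forall f, polyfun (@mxentry _ m n) f ->
    (forall k, `|f (x k)| <= k.+1%:R^-1) -> f a = 0.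
Proof.
move=> hx; have [U [uU sU]] := ultraFilterLemma eventually_filter.
have FU : ProperFilter U by exact: ultra_proper.
have /boolp.choice[a ha] (ij : 'I_m * 'I_n) := ultra_bounded_complex uU (fun k
  => hx k ij.1 ij.2).
exists (\matrix_(i, j) a (i, j)) => f pf hf; set A := \matrix_(i, j) _.
have cvf : f (x k) @[k --> U] --> (f A : (R[i] : numFieldType)).
  apply: cvg_polyfun pf => v [i [j ->]]; apply/cvgrPdist_lt => e e0.
  by rewrite mxE; apply: (ha (i, j)).
apply/eqP; apply: contrapT => /negP; rewrite -normr_gt0 => fA0.
have e0 : 0 < `|f A| / 2 by rewrite divr_gt0.
have [N hN] := invn_lt e0.
have Ucvf := (@cvgrPdist_lt (R[i] : numFieldType) (R[i] : numFieldType) _ U _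
  (fun k => f (x k)) (f A)).1 cvf.
have UN : U [set k | (N <= k)%N] by apply: sU; exact: nbhs_infty_ge.
have [k [/= h1 h2]] := filter_ex (filterI (Ucvf _ _ e0) UN).
have : `|f A| < `|f A|.
  rewrite -{1}[f A](subrK (f (x k))).
  rewrite (le_lt_trans (ler_normD _ _)) // [ltRHS](splitr `|f A|) ltrD //.
  by rewrite (le_lt_trans (hf k)) // hN.
by rewrite ltxx.
Qed.

End UltraLimit.

(** * Maximal minors *)

Section Minors.
Variables (K : fieldType) (n m : nat).
Implicit Types (A : 'M[K]_(n, m)) (f : {ffun 'I_n -> 'I_m}).

Definition minor f A : K := \det (colsub f A).

Definition semi_invariant (L : 'M[K]_(n, m) -> K) : Prop :=
  forall g A, L (g *m A) = \det g * L A.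

Lemma minor_semi_invariant f : semi_invariant (minor f).
Proof. by move=> g A; rewrite /minor -mulmx_colsub det_mulmx. Qed.

Lemma polyfun_minor f : polyfun (@mxentry K n m) (minor f).
Proof.
apply: polyfun_det => i j; apply: polyfun_ext (@polyfun_mxentry K n m i (f j))
  => A.
by rewrite mxE.
Qed.

Lemma row_free_minor A : row_free A -> exists f, minor f A != 0.
Proof.
move=> fA; have rA : row_full A^T by rewrite /row_full mxrank_tr.
have := fullrowsub_unit rA; rewrite unitmxE unitfE => dA.
exists (fullrankfun rA); move: dA; rewrite /minor -det_tr.
by congr (\det _ != 0); apply/matrixP => i j; rewrite !mxE.
Qed.

Lemma minor_row_free f A : minor f A != 0 -> row_free A.
Proof.
rewrite -unitfE -unitmxE => uA; rewrite -kermx_eq0; apply/eqP.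
have : kermx A *m colsub f A = 0.
  by rewrite mulmx_colsub mulmx_ker; apply/matrixP => i j; rewrite !mxE.
by move=> /(congr1 (mulmx^~ (invmx (colsub f A)))); rewrite mulmxK // mul0mx.
Qed.

Definition set_col f (i : 'I_n) (j : 'I_m) : {ffun 'I_n -> 'I_m} :=
  [ffun k => if k == i then j else f k].

(** The cofactors along column [i] do not involve that column, so they are those of the identity.
    Hence every entry of a normalized matrix is itself a maximal minor. *)
Lemma minor_set_col f A i j : colsub f A = 1%:M -> minor (set_col f i j) A = A i
  j.
Proof.
move=> fA; rewrite /minor (expand_det_col _ i) (bigD1 i) //=.
have cofE k : cofactor (colsub (set_col f i j) A) k i = (k == i)%:R.
  have -> : cofactor (colsub (set_col f i j) A) k i = cofactor (colsub f A) k i.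
    rewrite /cofactor; congr (_ * \det _); apply/matrixP => p q.
    by rewrite !mxE ffunE eq_sym (negPf (neq_lift i q)).
  have := mul_mx_adj (colsub f A); rewrite {1}fA mul1mx fA det1 => /matrixP/(_ i
    k).
  by rewrite !mxE eq_sym.
rewrite cofE eqxx mulr1 big1 ?addr0 => [|k ki]; last by rewrite cofE (negPf ki)
  mulr0.
by rewrite !mxE ffunE eqxx.
Qed.

End Minors.

(** * Finiteness of projective sets that miss a hyperplane section *)

Section FiniteProjective.
Variables (R : realType) (n m : nat).
Let K := R[i].
Implicit Types (A B : 'M[K]_(n, m)) (f : {ffun 'I_n -> 'I_m}).

(** Dividing by a minor of largest modulus expresses the compactness of the Grassmannian: the
    representatives stay bounded while one minor equals 1. *)
Lemma normalized_minors A : row_free A -> exists f, [/\ minor f A != 0,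
  forall g, minor g (invmx (colsub f A) *m A) = minor g A / minor f A &
  forall g, `|minor g (invmx (colsub f A) *m A)| <= 1].
Proof.
move=> /row_free_minor[f0 f0A].
pose F f := complex.Re `|minor f A|.
have FE f : `|minor f A| = (F f)%:C%C by rewrite RRe_real // normr_real.
case: (@arg_maxP _ R _ f0 xpredT F isT) => f _ fmax.
have fA : minor f A != 0.
  by rewrite -normr_gt0 (lt_le_trans (y := `|minor f0 A|)) ?normr_gt0 // !FE
    lecR; exact: fmax.
have minorE g : minor g (invmx (colsub f A) *m A) = minor g A / minor f A.
  by rewrite minor_semi_invariant det_inv mulrC.
exists f; split=> // g; rewrite minorE normrM normfV ler_pdivrMr ?normr_gt0 //
  mul1r.
by rewrite !FE lecR; exact: fmax.
Qed.

Lemma normalizedE A f i j : minor f A != 0 ->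
  (invmx (colsub f A) *m A) i j = minor (set_col f i j) (invmx (colsub f A) *m
    A).
Proof.
by move=> fA; rewrite minor_set_col // -mulmx_colsub mulVmx // unitmxE unitfE.
Qed.

Variables (I : finType) (P : I -> 'M[K]_(n, m) -> K).
Hypothesis polyP : forall i, polyfun (@mxentry K n m) (P i).
Let Z A := forall i, P i A = 0.
Hypothesis ZGL : forall g A, g \in unitmx -> Z A -> Z (g *m A).
Variable L : 'M[K]_(n, m) -> K.
Hypotheses (polyL : polyfun (@mxentry K n m) L) (semiL : semi_invariant L).
Hypothesis L_neq0 : forall A, row_free A -> Z A -> L A != 0.

(* The functions [minor f / L] are bounded on [Z] modulo [GL_n]: along a
   sequence on which one of them tended to infinity, normalized representatives would
   converge to a point of [Z] where [L] vanishes. Hence they do not take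
   cofinitely many values. *)
Lemma minor_ratio_finite f : exists s : seq K,
  forall A, row_free A -> Z A -> minor f A / L A \in s.
Proof.
(* Variable 0 is reserved for the ratio; the matrix entries occupy the variables 1 to [n * m]. *)
pose mx_of (e : nat -> K) : 'M[K]_(n, m) := \matrix_(i, j) e (i * m + j).+1.
have poly_mx g : polyfun (@mxentry K n m) g -> polyfun (@coordinate _) (fun e =>
  g (mx_of e)).
  apply: polyfun_comp => v [i [j ->]].
  by apply: polyfun_ext (@polyfun_coord K (i * m + j).+1) => e; rewrite mxE.
pose l := iota 1 (n * m).
pose S e := (forall i, i \in enum I -> P i (mx_of e) = 0) /\ (L (mx_of e) <> 0
  /\
  minor f (mx_of e) = e 0%N * L (mx_of e)).
have cS : constr S.
  apply: constr_and.
    by apply: (constr_all (P := fun i e => P i (mx_of e) = 0) (enum I)) => i;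
      apply/constr_eq0/poly_mx.
  apply: constr_and; first exact/constr_not/constr_eq0/poly_mx.
  apply: constr_eq; first exact/poly_mx/polyfun_minor.
  by apply: polyfun_mul; [exact: polyfun_coord | exact: poly_mx].
have SA u : exl l S (upd (fun=> 0) 0 u) <->
    exists A, [/\ Z A, L A != 0 & minor f A = u * L A].
  split=> [[e ee' [Pe [/eqP Le fe]]]|[A [ZA LA fA]]].
    exists (mx_of e); split=> // [i|]; first by apply: Pe; rewrite mem_enum.
    by rewrite fe -ee' // mem_iota.
  pose e k := if k is k'.+1 then
    if insub (k' %/ m)%N is Some i then if insub (k' %% m)%N is Some j then A i
      j else 0 else 0
    else u.
  have eA : mx_of e = A.
    apply/matrixP => i j; rewrite mxE /e.
    have m0 : (0 < m)%N by case: m j => [[]|].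
    rewrite divnMDl // divn_small // addn0 modnMDl modn_small //.
    by rewrite (valK i) (valK j).
  exists e; last by split; rewrite ?eA //; split=> //; apply/eqP.
  move=> [|k]; first by rewrite /upd.
  rewrite mem_iota /= add1n ltnS /upd /= => kl; case: insubP => // i _ ik.
  case: insubP => // j _ jk; move: kl; rewrite -leqNgt => nmk.
  have : (k %/ m < n)%N by rewrite -ik ltn_ord.
  have m0 : (0 < m)%N by case: m j {jk} => [[]|].
  by rewrite ltn_divLR // ltnNge nmk.
have [[s hs]|[s hs]] := constr_dichotomy 0 (fun=> 0) (constr_exl l cS).
  exists s => A fA ZA; apply: hs; apply/SA; exists A; split=> //;
    first exact: L_neq0.
  by rewrite divfK // L_neq0.
exfalso.
have large k : exists2 N, (k < N)%N & N%:R \notin s.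
  apply: contrapT => nN; pose t := [seq (k.+1 + i)%:R : K | i <- iota 0 (size
    s).+1].
  have : (size t <= size s)%N.
    apply: uniq_leq_size.
      by rewrite map_inj_uniq ?iota_uniq // => i j /eqP;
        rewrite eqr_nat eqn_add2l => /eqP.
    move=> x /mapP[i _ ->]; apply: contrapT => /negP xs.
    by apply: nN; exists (k.+1 + i)%N => //; rewrite leq_addr.
  by rewrite size_map size_iota ltnn.
(* A ratio [N] larger than [k] forces the normalized value of [L] below 1/N. The product says that
   some minor equals 1 without naming it, a polynomial equation through which rank [n] survives the
   limit. *)
have point k : exists B, [/\ Z B, forall i j, `|B i j| <= 1, `|L B| <=
  k.+1%:R^-1 &
    \prod_(g : {ffun 'I_n -> 'I_m}) (minor g B - 1) = 0].
  have [N kN Ns] := large k.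
  have [|A [ZA LA fA]] := (SA N%:R).1.
    by apply: contrapT => /hs; apply/negP.
  have N0 : N%:R != 0 :> K by rewrite pnatr_eq0 -lt0n (leq_trans _ kN).
  have rA : row_free A.
    by apply: (@minor_row_free _ _ _ f); rewrite fA mulf_neq0.
  have [h [hA minorE minor_le1]] := normalized_minors rA.
  have uh : colsub h A \in unitmx by rewrite unitmxE unitfE.
  exists (invmx (colsub h A) *m A); split.
  - by apply: ZGL => //; rewrite unitmx_inv.
  - by move=> i j; rewrite normalizedE.
  - have := minor_le1 f; rewrite minor_semi_invariant fA mulrCA -semiL normrM
    normr_nat.
    move=> le1; rewrite -[k.+1%:R^-1]mul1r ler_pdivlMr ?ltr0Sn // mulrC.
    by rewrite (le_trans _ le1) // ler_wpM2r // ler_nat.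
  - by rewrite (bigD1 h) //= minorE divff // subrr mul0r.
have /boolp.choice[B hB] := point.
have [a ha] := bounded_mx_limit (fun k => let: And4 _ h _ _ := hB k in h).
have Za : Z a.
  move=> i; apply: ha => // k; have [ZB _ _ _] := hB k.
  by rewrite ZB normr0 invr_ge0.
have La : L a = 0 by apply: ha => // k; have [] := hB k.
have /eqP : \prod_(g : {ffun 'I_n -> 'I_m}) (minor g a - 1) = 0.
  apply: (ha (fun A => \prod_(g : {ffun 'I_n -> 'I_m}) (minor g A - 1))).
    apply: polyfun_prod => g; apply: polyfun_sub; [exact: polyfun_minor|exact:
      polyfun_cst].
  by move=> k; have [_ _ _ ->] := hB k; rewrite normr0 invr_ge0.
move=> /prodf_eq0[g _]; rewrite subr_eq0 => /eqP ga.
have ra : row_free a by apply: (@minor_row_free _ _ _ g); rewrite ga oner_eq0.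
by have := L_neq0 ra Za; rewrite La eqxx.
Qed.

(** An entry of the normalized representative is a quotient of two minors, hence of two ratios to
    [L], each from a finite list. *)
Lemma finite_mod_GL : exists s : seq 'M[K]_(n, m), forall A, row_free A -> Z A
  ->
  exists2 B, B \in s & exists2 g, g \in unitmx & A = g *m B.
Proof.
have /boolp.choice[s hs] := minor_ratio_finite.
pose t := flatten [seq s f | f : {ffun 'I_n -> 'I_m}].
pose q := [seq x / y | x <- t, y <- t].
pose mx_of (c : {ffun 'I_n * 'I_m -> seq_sub q}) : 'M[K]_(n, m) := \matrix_(i,
  j) val (c (i, j)).
exists [seq mx_of c | c : {ffun 'I_n * 'I_m -> seq_sub q}] => A rA ZA.
have [h [hA minorE _]] := normalized_minors rA.
have uh : colsub h A \in unitmx by rewrite unitmxE unitfE.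
exists (invmx (colsub h A) *m A); last by exists (colsub h A);
  rewrite // mulKVmx.
have LA := L_neq0 rA ZA.
have tP f : minor f A / L A \in t.
  by apply/flatten_mapP; exists f; [rewrite mem_enum | exact: hs].
have qP i j : (invmx (colsub h A) *m A) i j \in q.
  rewrite normalizedE // minorE; apply/allpairsP.
  exists (minor (set_col h i j) A / L A, minor h A / L A); rewrite !tP;
    split=> //=.
  by rewrite invfM invrK mulrACA mulVf ?mulr1.
apply/mapP; exists [ffun ij => SeqSub (qP ij.1 ij.2)];
  first by rewrite mem_enum.
by apply/matrixP => i j; rewrite [RHS]mxE ffunE.
Qed.

End FiniteProjective.

(** * Schubert positions of Lagrangian subspaces *)

Section Position.
Variables (K : fieldType) (n : nat).
Implicit Types (k l m : 'I_n) (j : 'I_(n + n)) (mu lam : {set 'I_n}) (C :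
  'M[K]_(n, n + n)).

(** [lo k] and [hi k] are dual for the form. When entries are coefficients of a polynomial, a first
    nonzero entry at [lo k] means order n - k - 1 at 0, the order attached to step n + k + 1 of the
    flag. *)
Definition lo k : 'I_(n + n) := lshift n (rev_ord k).
Definition hi k : 'I_(n + n) := rshift n k.

Lemma lo_val k : lo k = (n - k.+1)%N :> nat. Proof. by []. Qed.
Lemma hi_val k : hi k = (n + k)%N :> nat. Proof. by []. Qed.

Lemma rev_lo k : rev_ord (lo k) = hi k.
Proof. by apply: val_inj; rewrite /=; have := ltn_ord k; lia. Qed.

Lemma rev_hi k : rev_ord (hi k) = lo k.
Proof. by rewrite -rev_lo rev_ordK. Qed.

Lemma lo_hi_cases j : exists k, j = lo k \/ j = hi k.
Proof.
case: (split_ordP j) => k ->; last by exists k; right.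
by exists (rev_ord k); left; rewrite /lo rev_ordK.
Qed.

Lemma lo_inj : injective lo.
Proof. by move=> k l /lshift_inj/rev_ord_inj. Qed.

Lemma hi_inj : injective hi.
Proof. exact: rshift_inj. Qed.

Lemma lo_neq_hi k l : (lo k == hi l) = false.
Proof. by rewrite eq_lrshift. Qed.

(** The index sets of the coordinate Lagrangian subspaces: one index from each dual pair. *)
Definition column mu : {ffun 'I_n -> 'I_(n + n)} :=
  [ffun k => if k \in mu then lo k else hi k].

Lemma column_inj mu : injective (column mu).
Proof.
move=> k l; rewrite !ffunE; case: ifP; case: ifP => // _ _.
- exact: lo_inj.
- by move/eqP; rewrite lo_neq_hi.
- by move/eqP; rewrite eq_sym lo_neq_hi.
- exact: hi_inj.
Qed.

Lemma column_rev mu k l : (column mu k == rev_ord (column mu l)) = false.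
Proof.
rewrite !ffunE; case: ifP => kl; case: ifP => ll; rewrite ?rev_lo ?rev_hi.
- exact: lo_neq_hi.
- by apply: contraFF ll => /eqP/lo_inj <-.
- by apply: contraFF kl => /eqP/hi_inj ->.
- by rewrite eq_sym lo_neq_hi.
Qed.

(* The element [k] of ['I_n] stands for the part [k + 1]. *)
Definition weight mu : nat := (\sum_(k in mu) k.+1)%N.

Definition above mu (i : nat) := [set k in mu | (i <= k)%N].

Lemma weight_above mu : weight mu = (\sum_(i < n) #|above mu i|)%N.
Proof.
transitivity (\sum_(i < n) \sum_(k in mu) (i <= k))%N; last first.
  apply: eq_bigr => i _; rewrite -sum1_card [RHS](eq_bigl (fun k => (k \in mu)
    && (i <= k)%N)).
    by rewrite -big_mkcondr.
  by move=> k; rewrite inE.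
rewrite exchange_big; apply: eq_bigr => k _ /=.
have -> : (\sum_(i < n) (i <= k) = \sum_(i < n | i < k.+1) 1)%N.
  by rewrite [RHS]big_mkcond; apply: eq_bigr => i _; rewrite ltnS; case: leq.
by rewrite -(big_ord_widen n (fun=> 1%N) (ltn_ord k)) big_const_ord iter_addn_0
  mul1n.
Qed.

Lemma above_eq lam mu : (forall i, #|above lam i| = #|above mu i|) -> lam = mu.
Proof.
move=> h; have cnt nu k : #|above nu k| = ((k \in nu) + #|above nu k.+1|)%N.
  rewrite (cardsD1 k) inE leqnn andbT; congr (_ + #|pred_of_set _|)%N.
  by apply/setP => l; rewrite !inE ltn_neqAle eq_sym; case: (l \in nu);
    rewrite ?andbF ?andbT.
apply/setP => k; have := h k; rewrite !cnt h => /eqP; rewrite eqn_add2r.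
by do 2!case: (k \in _).
Qed.

(** The counts [#|above mu i|] add up to the weight and determine the set, so termwise inequalities
    with equal sums are equalities. *)
Lemma weight_dominance lam mu : (forall i, (#|above lam i| <= #|above mu i|)%N)
  ->
  (weight lam < weight mu)%N \/ lam = mu.
Proof.
move=> h; have [lt|ge] := ltnP (weight lam) (weight mu); [by left|right].
have /leqif_sum eqs : forall i : 'I_n, xpredT i ->
    (#|above lam i| <= #|above mu i| ?= iff (#|above lam i| == #|above mu
      i|))%N.
  by move=> i _; split.
have : (weight lam == weight mu).
  by rewrite eqn_leq ge !weight_above andbT leq_sum.
rewrite !weight_above eqs => /forallP eqi; apply: above_eq => i.
have [ni|ni] := leqP n i; last by have /eqP := eqi (Ordinal ni).
have above0 nu : above nu i = finset.set0.
  by apply/setP => k; rewrite !inE [(i <= k)%N]leqNgt (leq_trans (ltn_ord k) ni)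
    andbF.
by rewrite !above0.
Qed.

Variable C : 'M[K]_(n, n + n).

Definition leading_at k : Prop := exists v : 'rV[K]_(n + n),
  [/\ (v <= C)%MS, forall j, (j < lo k)%N -> v 0 j = 0 & v 0 (lo k) != 0].

Definition low_positions : {set 'I_n} := [set k | `[< leading_at k >]].

Lemma low_positionsP k : reflect (leading_at k) (k \in low_positions).
Proof. by rewrite inE; exact: asboolP. Qed.

Lemma first_nonzero (v : 'rV[K]_(n + n)) j0 : v 0 j0 != 0 ->
  exists j, [/\ v 0 j != 0, (j <= j0)%N & forall j', (j' < j)%N -> v 0 j' = 0].
Proof.
move=> vj0; case: (@arg_minnP _ j0 (fun j => v 0 j != 0) val vj0) => j vj jmin.
exists j; split=> // [|j' j'j]; first exact: jmin.
by apply: contraTeq j'j => /jmin; rewrite -leqNgt.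
Qed.

Lemma low_vanish (v : 'rV[K]_(n + n)) (t : nat) : (v <= C)%MS ->
  (forall k, k \in low_positions -> (t <= k)%N -> v 0 (lo k) = 0) ->
  forall k, (t <= k)%N -> v 0 (lo k) = 0.
Proof.
move=> vC v0 k tk; have [//|/first_nonzero[j [vj jk jmin]]] := eqVneq (v 0 (lo
  k)) 0.
have [l [jl|jl]] := lo_hi_cases j; last first.
  by move: jk; rewrite jl lo_val hi_val leqNgt; case/negP; have := ltn_ord k;
    lia.
rewrite {}jl in vj jk jmin; have := vj; rewrite v0 ?eqxx //.
  by apply/low_positionsP; exists v.
by move: jk; rewrite !lo_val; have := ltn_ord k; have := ltn_ord l; lia.
Qed.

Variable b : 'I_(n + n) -> K.
Hypothesis b_neq0 : forall j, b j != 0.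

Definition form_mx : 'M[K]_(n + n) := \matrix_(i, j) (b i *+ (j == rev_ord i)).

Lemma form_mxE (u v : 'rV[K]_(n + n)) :
  (u *m form_mx *m v^T) 0 0 = \sum_j b j * u 0 j * v 0 (rev_ord j).
Proof.
rewrite !mxE (reindex_inj rev_ord_inj); apply: eq_bigr => j _.
rewrite !mxE (bigD1 j) //= mxE eqxx mulr1n big1 ?addr0 => [|i ij].
  by rewrite [u 0 j * _]mulrC.
by rewrite mxE (inj_eq rev_ord_inj) eq_sym (negPf ij) mulr0.
Qed.

(** A nonzero vector of [C] that vanishes on these columns must start at some [hi k] with [k] a low
    position. It then pairs nontrivially with a vector of [C] that starts at [lo k], since in every
    other term one factor is zero. *)
Lemma minor_low_positions : row_free C -> C *m form_mx *m C^T = 0 ->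
  minor (column low_positions) C != 0.
Proof.
move=> fC isoC; apply/negP => /det0P[x x0 xC]; pose v := x *m C.
have vC : (v <= C)%MS by exact: submxMl.
have v_col k : v 0 (column low_positions k) = 0.
  by have /matrixP/(_ 0 k) := xC; rewrite mulmx_colsub !mxE.
have [j0 vj0] : exists j, v 0 j != 0.
  have : v != 0 by rewrite /v mulmx_free_eq0.
  by case/rV0Pn => j vj; exists j.
have [j [vj _ jmin]] := first_nonzero vj0.
have [k [jk|jk]] := lo_hi_cases j.
  have kl : k \in low_positions by apply/low_positionsP; exists v; rewrite -jk.
  by move: vj; rewrite jk; have := v_col k; rewrite ffunE kl => ->;
    rewrite eqxx.
have kl : k \in low_positions.
  apply: contraT => kl; have := v_col k; rewrite ffunE (negPf kl) -jk => vj'.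
  by rewrite vj' eqxx in vj.
have /low_positionsP[u [uC u0 uk]] := kl.
have : (u *m form_mx *m v^T) 0 0 = 0.
  have /submxP[y ->] := uC.
  by rewrite /v trmx_mul !mulmxA -[y *m _ *m _]mulmxA -[y *m _ *m _]mulmxA isoC
    mulmx0 mul0mx mxE.
rewrite form_mxE (bigD1 (lo k)) //= big1 ?addr0 => [/eqP|i ik].
  by rewrite !mulf_eq0 (negPf (b_neq0 _)) (negPf uk) rev_lo -jk (negPf vj).
have [ik'|ik'] := ltnP i (lo k); first by rewrite u0 // mulr0 mul0r.
rewrite jmin ?mulr0 // jk /=; move: ik ik'; rewrite -val_eqE /= => ik ik'.
by have := ltn_ord k; have := ltn_ord i; lia.
Qed.

(** Normalize at the columns of [lam]. A combination of the rows in [above lam t] that vanishes at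
    the low positions from [t] on vanishes at all [lo k] with [t <= k], by [low_vanish]; its
    coefficients are among these entries. This bounds the number of such rows. *)
Lemma minor_neq0_position lam : minor (column lam) C != 0 ->
  (weight lam < weight low_positions)%N \/ lam = low_positions.
Proof.
move=> lC; apply: weight_dominance => t.
have uC : colsub (column lam) C \in unitmx by rewrite unitmxE unitfE.
pose D := invmx (colsub (column lam) C) *m C.
have DC : colsub (column lam) D = 1%:M by rewrite -mulmx_colsub mulVmx.
pose S := above lam t; pose S' := above low_positions t.
pose M : 'M[K]_(#|S|, #|S'|) := \matrix_(p, q) D (enum_val p) (lo (enum_val q)).
suff : row_free M by rewrite -row_leq_rank => /leq_trans; apply;
  exact: rank_leq_col.
rewrite -kermx_eq0; apply/rowV0P => x /sub_kermxP xM.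
pose v := x *m rowsub enum_val D.
have vC : (v <= C)%MS.
  by rewrite /v /D -mul_rowsub_mx mulmxA submxMl.
have v0 : forall k, (t <= k)%N -> v 0 (lo k) = 0.
  apply: low_vanish => // k kl tk.
  have kS : k \in S' by rewrite inE kl.
  have /matrixP/(_ 0 (enum_rank_in kS k)) := xM; rewrite [RHS]mxE => <-.
  by rewrite /v !mxE; apply: eq_bigr => p _; rewrite !mxE enum_rankK_in.
apply/rowP => p; rewrite mxE; have := enum_valP p; rewrite inE => /andP[pl /v0
  <-].
rewrite mxE (bigD1 p) //= big1 ?addr0 => [|q qp].
  have /matrixP/(_ (enum_val p) (enum_val p)) := DC.
  by rewrite !mxE ffunE pl eqxx => ->; rewrite mulr1.
have /matrixP/(_ (enum_val q) (enum_val p)) := DC.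
rewrite !mxE ffunE pl (inj_eq enum_val_inj) (negPf qp) => ->.
by rewrite mulr0.
Qed.

(* The Lagrangian subspaces in Schubert position [lam], together with those of
   smaller weight. *)
Definition in_schubert lam : Prop := forall mu,
  mu != lam -> (weight lam <= weight mu)%N -> minor (column mu) C = 0.

Lemma in_schubert_low : in_schubert low_positions.
Proof.
move=> mu ne le; apply/eqP; apply: contraT => /minor_neq0_position[|eq].
  by rewrite ltnNge le.
by rewrite eq eqxx in ne.
Qed.

Lemma in_schubertP lam : row_free C -> C *m form_mx *m C^T = 0 -> in_schubert
  lam ->
  (weight low_positions < weight lam)%N \/ low_positions = lam.
Proof.
move=> fC isoC hC; have [|le] := ltnP (weight low_positions) (weight lam);
  [by left|right].
apply/eqP; apply: contraTT isT => ne.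
by have := minor_low_positions fC isoC; rewrite hC ?eqxx.
Qed.

Lemma in_schubert_eq0 lam : row_free C -> C *m form_mx *m C^T = 0 -> in_schubert
  lam ->
  minor (column lam) C = 0 -> (weight low_positions < weight lam)%N.
Proof.
move=> fC isoC hC l0; have [//|low] := in_schubertP fC isoC hC.
by have := minor_low_positions fC isoC; rewrite low l0 eqxx.
Qed.

Lemma in_schubert_neq0 lam : row_free C -> C *m form_mx *m C^T = 0 ->
  in_schubert lam ->
  minor (column lam) C != 0 -> low_positions = lam.
Proof.
move=> fC isoC hC /minor_neq0_position[lt|//].
by have [|//] := in_schubertP fC isoC hC; rewrite ltnNge ltnW.
Qed.

End Position.

(** * Affine coordinates on the Schubert cells *)

Section Family.
Variables (K : fieldType) (n : nat).
Variable b : 'I_(n + n) -> K.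
Hypothesis b_rev : forall j, b (rev_ord j) = - b j.
Variable lam : {set 'I_n}.
Implicit Types (e : nat -> K) (k l m : 'I_n).
Let col := column lam.

Lemma sum_columns (F : 'I_(n + n) -> K) :
  \sum_j F j = \sum_k (F (col k) + F (rev_ord (col k))).
Proof.
rewrite big_split_ord (reindex_inj rev_ord_inj) /= -big_split;
  apply: eq_bigr => k _ /=.
rewrite -/(lo k) -/(hi k) /col ffunE; case: ifP => _; rewrite ?rev_lo //.
by rewrite rev_hi addrC.
Qed.

(** A symmetric matrix stored by its lower triangle, zero where the larger index lies outside [lam].
    Each [k] in [lam] leaves k + 1 free entries, in total the weight. *)
Definition parameter e k l : K :=
  let i := if (k <= l)%N then l else k in
  let j := if (k <= l)%N then k else l in
  if i \in lam then e (i * n + j)%N else 0.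

Lemma parameterC e k l : parameter e k l = parameter e l k.
Proof.
rewrite /parameter; case: (ltngtP k l) => // /val_inj -> //.
Qed.

(* The Schubert cell of [lam], as the graphs of symmetric matrices. *)
Definition cell_mx e : 'M[K]_(n, n + n) := \matrix_(k, j)
  ((j == col k)%:R + \sum_m b (col k) * parameter e k m * (j == rev_ord (col
    m))%:R).

Lemma cell_mx_column e k l : cell_mx e k (col l) = (k == l)%:R.
Proof.
rewrite mxE (inj_eq (@column_inj _ lam)) eq_sym big1 ?addr0 // => m _.
by rewrite /col column_rev mulr0.
Qed.

Lemma cell_mx_rev e k l : cell_mx e k (rev_ord (col l)) = b (col k) * parameter
  e k l.
Proof.
rewrite mxE eq_sym column_rev add0r (bigD1 l) //= eqxx mulr1 big1 ?addr0 // => m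
  ml.
by rewrite (inj_eq rev_ord_inj) (inj_eq (@column_inj _ lam)) eq_sym (negPf ml)
  mulr0.
Qed.

Lemma colsub_cell_mx e : colsub col (cell_mx e) = 1%:M.
Proof. by apply/matrixP => k l; rewrite mxE cell_mx_column mxE. Qed.

Lemma minor_cell_mx e : minor col (cell_mx e) = 1.
Proof. by rewrite /minor colsub_cell_mx det1. Qed.

(** The factor [b (col k)] in [cell_mx] makes the pairing of rows [k] and [l] a multiple of the
    difference of two transposed parameters. *)
Lemma cell_mx_isotropic e : cell_mx e *m form_mx b *m (cell_mx e)^T = 0.
Proof.
apply/matrixP => k l; rewrite [RHS]mxE.
have -> : (cell_mx e *m form_mx b *m (cell_mx e)^T) k l =
    (row k (cell_mx e) *m form_mx b *m (row l (cell_mx e))^T) 0 0.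
  by rewrite -row_mul tr_row !mxE; apply: eq_bigr => j _; rewrite !mxE.
rewrite form_mxE sum_columns.
under eq_bigr => m _ do
  rewrite rev_ordK !(mxE _ _ 0) !cell_mx_column !cell_mx_rev b_rev.
rewrite big_split /= (bigD1 k) //= eqxx big1 ?addr0; last first.
  by move=> m mk; rewrite eq_sym (negPf mk) mulr0 mul0r.
rewrite (bigD1 l) //= eqxx big1 ?addr0; last first.
  by move=> m ml; rewrite [l == m]eq_sym (negPf ml) mulr0.
by rewrite [parameter e l k]parameterC /= !mulr1 !mulNr mulrCA subrr.
Qed.

(** A combination that starts at [lo k] with [k] outside [lam] would have entry zero there: rows
    [m <= k] and rows outside [lam] have zero parameter, and the coefficient of a row [m > k] in
    [lam] is the entry at the earlier index [lo m]. Equality then follows from the weights. *)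
Lemma low_positions_cell_mx e : low_positions (cell_mx e) = lam.
Proof.
have sub : low_positions (cell_mx e) \subset lam.
  apply/fintype.subsetP => k /low_positionsP[v [/submxP[x vx] v0 vk]].
  apply: contraNT vk => kl.
  have vE j : v 0 j = \sum_m x 0 m * cell_mx e m j by rewrite vx mxE.
  have vcol l : v 0 (col l) = x 0 l.
    rewrite vE (bigD1 l) //= cell_mx_column eqxx mulr1 big1 ?addr0 // => m ml.
    by rewrite cell_mx_column (negPf ml) mulr0.
  have -> : lo k = rev_ord (col k) by rewrite /col ffunE (negPf kl) rev_hi.
  rewrite vE big1 // => m _; rewrite cell_mx_rev /parameter.
  have [mk|km] := leqP m k; first by rewrite (negPf kl) !mulr0.
  case: ifP => ml; last by rewrite !mulr0.
  rewrite -vcol /col ffunE ml v0 ?mul0r // !lo_val.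
  by have := ltn_ord m; lia.
apply/esym; have : minor col (cell_mx e) != 0 by rewrite minor_cell_mx
  oner_neq0.
case/minor_neq0_position => //; rewrite ltnNge !weight_above leq_sum // => i _.
apply/subset_leq_card/fintype.subsetP => k; rewrite inE => /andP[kl ik].
by rewrite inE ik andbT; exact: (fintype.subsetP sub).
Qed.

Lemma polyfun_cell_mx i j : polyfun (@coordinate K)
  (fun e => cell_mx e i j).
Proof.
apply: (@polyfun_ext _ _ _ (fun e => (j == col i)%:R +
  \sum_m b (col i) * parameter e i m * (j == rev_ord (col m))%:R)).
  by move=> e; rewrite mxE.
apply: polyfun_add; first exact: polyfun_cst.
apply: polyfun_sum => m; apply: polyfun_mul; last exact: polyfun_cst.
apply: polyfun_mul; first exact: polyfun_cst.
by rewrite /parameter; case: (_ \in lam); [exact: polyfun_coord | exact: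
  polyfun_cst].
Qed.

End Family.

(** * Wronskians *)

Section Wronskian.
Variable K : numFieldType.
Implicit Types (p q f g : {poly K}) (s : K).

Lemma nonroot_nat p : p != 0 -> forall N, exists2 k, (N <= k)%N & ~~ root p
  k%:R.
Proof.
move=> p0 N; apply: contrapT => nk.
have := max_poly_roots p0 (rs := [seq (N + i)%:R : K | i <- iota 0 (size p)]).
rewrite size_map size_iota ltnn map_inj_uniq ?iota_uniq; last first.
  by move=> i j /eqP; rewrite eqr_nat eqn_add2l => /eqP.
suff -> : all (root p) [seq (N + i)%:R : K | i <- iota 0 (size p)] by move/(_
  isT isT).
apply/allP => x /mapP[i _ ->]; apply: contrapT => /negP nr.
by apply: nk; exists (N + i)%N; rewrite ?leq_addr.
Qed.

Definition vanishes m p s : Prop := forall k, (k < m)%N -> p^`(k).[s] = 0.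

Lemma derivn_mulXsubC k q s :
  (q * ('X - s%:P))^`(k.+1) = q^`(k.+1) * ('X - s%:P) + q^`(k) *+ k.+1.
Proof.
elim: k => [|k IH]; first by rewrite derivn1 derivM derivXsubC mulr1.
rewrite derivnS IH derivD derivM derivXsubC mulr1 derivMn -!derivnS.
by rewrite -addrA -mulrS.
Qed.

Lemma vanishes_dvdp m p s : vanishes m p s -> ('X - s%:P) ^+ m %| p.
Proof.
elim: m p => [|m IH] p hp; first by rewrite expr0 dvd1p.
have /factor_theorem[q pE] : root p s by apply/eqP; rewrite -(hp 0%N).
rewrite pE exprSr dvdp_mul2r ?polyXsubC_eq0 //; apply: IH => k km.
have := hp k.+1 km; rewrite pE derivn_mulXsubC hornerD hornerM hornerXsubC subrr
  mulr0 add0r.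
by rewrite hornerMn => /eqP; rewrite mulrn_eq0 => /eqP.
Qed.

(** Subtract the multiple of [g] that agrees with [f] at a point where [g] is nonzero. A nonzero
    difference [h] of order m + 1 there would give [h' g - h g'] order exactly m, in characteristic
    zero. *)
Lemma wronskian2_eq0 f g : g != 0 -> f^`() * g = f * g^`() -> exists c, f = c *:
  g.
Proof.
move=> g0 wr; have [k _ gk] := nonroot_nat g0 0; set s := k%:R in gk.
have gs : g.[s] != 0 by exact: gk.
exists (f.[s] / g.[s]); apply/eqP; rewrite -subr_eq0; set h := f - _.
have hs : root h s by rewrite /root hornerD hornerN hornerZ divfK // subrr.
have wrh : h^`() * g = h * g^`().
  by rewrite derivB derivZ !mulrBl wr -!scalerAl [g * _]mulrC.
have [//|h0] := eqVneq h 0; exfalso.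
have [m [u us hE]] := multiplicity_XsubC h s; rewrite h0 /= in us.
case: m hE => [|m] hE; first by rewrite hE mulr1 (negPf us) in hs.
pose Y := 'X - s%:P; have hE' : h = u * Y ^+ m * Y by rewrite hE exprSr mulrA.
have h'E : h^`() = u^`() * Y ^+ m * Y + u * Y ^+ m * m.+1%:R.
  rewrite hE derivM deriv_exp derivXsubC mul1r exprSr -mulr_natr !mulrA.
  by [].
have : ((u * m.+1%:R + u^`() * Y) * g - u * Y * g^`()) * Y ^+ m = h^`() * g - h
  * g^`().
  rewrite h'E hE'; ring.
rewrite wrh subrr => /eqP; rewrite mulf_eq0 expf_eq0 polyXsubC_eq0 andbF orbF.
move/eqP/(congr1 (horner^~ s))/eqP; rewrite hornerD hornerN !hornerM hornerD
  !hornerM.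
rewrite hornerXsubC subrr !mulr0 mul0r addr0 subr0 horner0 !mulf_eq0 (negPf gs)
  [u.[s] == 0](negPf us).
by rewrite orbF /= -polyC_natr hornerC pnatr_eq0.
Qed.

(** Taking the Wronskian of every polynomial with the first one, [g], preserves independence by
    [wronskian2_eq0] and lowers the order of vanishing by one. The coefficient of [g] is read off
    last, at a point where [g] is nonzero. *)
Lemma generic_order m (f : 'I_m -> {poly K}) :
  (forall c : 'I_m -> K, \sum_i c i *: f i = 0 -> forall i, c i = 0) ->
  exists2 q, q != 0 & forall s, ~~ root q s -> forall c : 'I_m -> K,
    ('X - s%:P) ^+ m %| \sum_i c i *: f i -> forall i, c i = 0.
Proof.
elim: m f => [|m IH] f free; first by exists 1 => [|s _ c _ []//];
  rewrite oner_neq0.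
pose g := f ord0; pose wr p := p^`() * g - p * g^`().
have wr_sum (c : 'I_m.+1 -> K) :
    wr (\sum_i c i *: f i) = \sum_i c (lift ord0 i) *: wr (f (lift ord0 i)).
  rewrite /wr big_ord_recl !linearD linear_sum /= linearZ /= !mulrDl opprD
    addrACA.
  rewrite -!scalerAl -/g [g * _]mulrC subrr add0r !mulr_suml -sumrB.
  by apply: eq_bigr => i _; rewrite linearZ /= -!scalerAl scalerBr.
have g0 : g != 0.
  apply/eqP => g0; have : \sum_i (i == ord0)%:R *: f i = 0.
    by rewrite big_ord_recl -/g g0 scaler0 add0r big1 // => i _;
      rewrite scale0r.
  by move/(free (fun i => (i == ord0)%:R))/(_ ord0)/eqP; rewrite eqxx oner_eq0.
have [|q q0 hq] := IH (fun i => wr (f (lift ord0 i))).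
  move=> c' hc'.
  pose c (a : K) (i : 'I_m.+1) := if unlift ord0 i is Some j then c' j else a.
  have c_lift a j : c a (lift ord0 j) = c' j by rewrite /c liftK.
  have c_ord0 a : c a ord0 = a by rewrite /c unlift_none.
  have /eqP : wr (\sum_i c 0 i *: f i) = 0.
    by rewrite wr_sum -[RHS]hc'; apply: eq_bigr => i _; rewrite c_lift.
  rewrite subr_eq0 => /eqP/(wronskian2_eq0 g0)[a ha] j.
  rewrite -(c_lift (- a)); apply: free.
  move: ha; rewrite !big_ord_recl !c_ord0 scale0r add0r -/g scaleNr => <-.
  apply/eqP; rewrite addrC subr_eq0; apply/eqP.
  by apply: eq_bigr => i _; rewrite !c_lift.
exists (q * g) => [|s]; first by rewrite mulf_neq0.
rewrite rootM negb_or => /andP[qs gs] c /dvdpP[h hE].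
have wr_dvd : ('X - s%:P) ^+ m %| wr (\sum_i c i *: f i).
  rewrite /wr hE derivM deriv_exp derivXsubC mul1r /= exprSr -mulr_natr.
  apply/dvdpP; pose Y := 'X - s%:P; rewrite -/Y.
  by exists ((h^`() * Y + h * m.+1%:R) * g - h * Y * g^`()); ring.
move: wr_dvd; rewrite wr_sum => /(hq _ qs) c0 i.
case: (unliftP ord0 i) => [j ->|->]; first exact: c0.
move/(congr1 (horner^~ s)): hE; rewrite big_ord_recl big1 ?addr0; last first.
  by move=> j _; rewrite c0 scale0r.
rewrite hornerM horner_exp hornerXsubC subrr expr0n mulr0 hornerZ => /eqP.
by rewrite mulf_eq0 [_.[s] == 0](negPf gs) orbF => /eqP.
Qed.

Variables (n d : nat).
Implicit Types (C : 'M[K]_(n, d)) (v : 'rV[K]_d).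

Definition jet_mx s : 'M[K]_(d, n) := \matrix_(i, k) ('X^i)^`(k).[s].

Lemma mul_jet_mx v s k : (v *m jet_mx s) 0 k = (rVpoly v)^`(k).[s].
Proof.
rewrite {2}[v]row_sum_delta linear_sum linear_sum horner_sum mxE.
apply: eq_bigr => i _.
by rewrite linearZ linearZ /= hornerZ rVpoly_delta mxE.
Qed.

Definition wronskian C s : K := \det (C *m jet_mx s).

Lemma wronskian_semi_invariant s : semi_invariant (fun C => wronskian C s).
Proof. by move=> g C; rewrite /wronskian -mulmxA det_mulmx. Qed.

Lemma polyfun_wronskian s : polyfun (@mxentry K n d) (fun C => wronskian C s).
Proof.
apply: polyfun_det; apply: polyfun_mulmx => i j; last exact: polyfun_cst.
exact: polyfun_mxentry.
Qed.

Lemma wronskian_eq0P C s : row_free C -> wronskian C s = 0 <->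
  exists v, [/\ v != 0, (v <= C)%MS & vanishes n (rVpoly v) s].
Proof.
move=> fC; split=> [/eqP/det0P[x x0 xC]|[v [v0 /submxP[x vx] hv]]].
  exists (x *m C); split; [by rewrite mulmx_free_eq0 | exact: submxMl | move=> k
    kn].
  by rewrite -(mul_jet_mx _ _ (Ordinal kn)) -mulmxA xC mxE.
apply/eqP/det0P; exists x; first by apply: contra_neq v0 => x0;
  rewrite vx x0 mul0mx.
by apply/rowP => k; rewrite mulmxA -vx mul_jet_mx mxE hv.
Qed.

Lemma wronskian_neq0 C : row_free C ->
  exists2 q : {poly K}, q != 0 & forall s, ~~ root q s -> wronskian C s != 0.
Proof.
move=> fC; have sumE (c : 'I_n -> K) :
    \sum_i c i *: rVpoly (row i C) = rVpoly ((\row_i c i) *m C).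
  rewrite mulmx_sum_row linear_sum; apply: eq_bigr => i _.
  by rewrite linearZ /= mxE.
have [|q q0 hq] := @generic_order n (fun i => rVpoly (row i C)).
  move=> c; rewrite sumE => /(congr1 (@poly_rV K d));
    rewrite rVpolyK linear0 => /eqP.
  by rewrite mulmx_free_eq0 // => /eqP/rowP c0 i; have := c0 i; rewrite !mxE.
exists q => // s qs; apply/eqP => /(wronskian_eq0P _ fC)[v [v0 /submxP[x vx]
  /vanishes_dvdp dv]].
case/eqP: v0; rewrite vx; suff -> : x = 0 by rewrite mul0mx.
apply/rowP => i; rewrite mxE; apply: (hq s qs (fun i => x 0 i)).
by rewrite sumE (_ : \row_i _ = x) -?vx //; apply/rowP => j; rewrite mxE.
Qed.

End Wronskian.

(** * Intersections of a Schubert variety with hyperplane sections *)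

Section Slices.
Variables (R : realType) (n : nat).
Let K := R[i].
Variable b : 'I_(n + n) -> K.
Hypotheses (b_neq0 : forall j, b j != 0) (b_rev : forall j, b (rev_ord j) = - b
  j).
Implicit Types (C B : 'M[K]_(n, n + n)) (mu lam : {set 'I_n}) (ss : seq R).

Definition lagrangian_mx C : Prop := row_free C /\ C *m form_mx b *m C^T = 0.

Lemma slice_finite mu (J : finType) (Q : J -> 'M[K]_(n, n + n) -> K) L :
  (forall j, polyfun (@mxentry K n (n + n)) (Q j)) -> (forall j, semi_invariant
    (Q j)) ->
  polyfun (@mxentry K n (n + n)) L -> semi_invariant L ->
  (forall C, lagrangian_mx C -> in_schubert C mu -> (forall j, Q j C = 0) -> L C
    != 0) ->
  exists s : seq 'M[K]_(n, n + n), forall C, lagrangian_mx C -> in_schubert C mu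
    ->
    (forall j, Q j C = 0) -> exists2 B, B \in s & exists2 g, g \in unitmx & C =
      g *m B.
Proof.
move=> pQ sQ pL sL L0.
pose P (i : ('I_n * 'I_n) + ({set 'I_n} + J)) C := match i with
  | inl ij => (C *m form_mx b *m C^T) ij.1 ij.2
  | inr (inl nu) => ((nu != mu) && (weight mu <= weight nu)%N)%:R * minor
    (column nu) C
  | inr (inr j) => Q j C
  end.
have ZP C : (forall i, P i C = 0) <->
    [/\ C *m form_mx b *m C^T = 0, in_schubert C mu & forall j, Q j C = 0].
  split=> [PC|[isoC hC QC] [[i j]|[nu|j]] /=].
  - split=> [|nu nu_mu le|j]; last exact: (PC (inr (inr j))).
      by apply/matrixP => i j; rewrite [RHS]mxE; exact: (PC (inl (i, j))).
    by have /= := PC (inr (inl nu)); rewrite nu_mu le mul1r.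
  - by rewrite isoC mxE.
  - by case: andP => [[ne le]|_]; rewrite ?mul0r // mul1r hC.
  - exact: QC.
have pP i : polyfun (@mxentry K n (n + n)) (P i).
  move: i => [[i j]|[nu|j]] /=; last exact: pQ.
    apply: polyfun_mulmx => {}i {}j; last first.
      by apply: polyfun_ext (@polyfun_mxentry K n (n + n) j i) => C;
        rewrite mxE.
    by apply: polyfun_mulmx => ? ?; [exact: polyfun_mxentry | exact:
      polyfun_cst].
  by apply: polyfun_mul; [exact: polyfun_cst | exact: polyfun_minor].
have PGL g C : g \in unitmx -> (forall i, P i C = 0) -> forall i, P i (g *m C) =
  0.
  move=> _ /ZP[isoC hC QC]; apply/ZP; split.
  - by rewrite trmx_mul !mulmxA -2!(mulmxA g) isoC mulmx0 mul0mx.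
  - by move=> nu ne le; rewrite minor_semi_invariant hC // mulr0.
  - by move=> j; rewrite sQ QC mulr0.
have PL C : row_free C -> (forall i, P i C = 0) -> L C != 0.
  by move=> fC /ZP[isoC hC QC]; apply: L0.
have [s hs] := finite_mod_GL pP PGL pL sL PL.
by exists s => C [fC isoC] hC QC; apply: hs => //; apply/ZP.
Qed.

Definition on_hyperplanes ss C : Prop := forall s, s \in ss -> wronskian C
  s%:C%C = 0.

(** The case of negative expected dimension. It is required for all [mu] at once because the
    induction on the points and the reduction to the open cell both pass to smaller weights. *)
Definition generic_points ss : Prop := forall mu C, lagrangian_mx C ->
  in_schubert C mu -> (weight mu < size ss)%N -> ~ on_hyperplanes ss C.

Lemma generic_points_minor ss lam C : generic_points ss -> weight lam = size ss
  ->
  lagrangian_mx C -> in_schubert C lam -> on_hyperplanes ss C ->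
  minor (column lam) C != 0.
Proof.
move=> gs wl [fC isoC] hC onC; apply/eqP => l0.
have lt := in_schubert_eq0 b_neq0 fC isoC hC l0.
apply: (gs (low_positions C) C) => //; last by rewrite -wl.
exact: in_schubert_low.
Qed.

Lemma generic_points_finite ss lam : generic_points ss -> weight lam = size ss
  ->
  exists Bs : seq 'M[K]_(n, n + n), forall C, lagrangian_mx C -> in_schubert C
    lam ->
    on_hyperplanes ss C -> exists2 B, B \in Bs & exists2 g, g \in unitmx & C = g
      *m B.
Proof.
move=> gs wl; pose Q (j : 'I_(size ss)) C := wronskian C (nth 0 ss j)%:C%C.
have onQ C : on_hyperplanes ss C <-> forall j, Q j C = 0.
  split=> [onC j|QC s /(nthP 0)[j js <-]]; first exact/onC/mem_nth.
  exact: (QC (Ordinal js)).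
have minor_neq0 C : lagrangian_mx C -> in_schubert C lam -> (forall j, Q j C =
  0) ->
    minor (column lam) C != 0.
  by move=> lC hC /onQ; apply: generic_points_minor.
have pQ j : polyfun (@mxentry K n (n + n)) (Q j) by exact: polyfun_wronskian.
have sQ j : semi_invariant (Q j) by exact: wronskian_semi_invariant.
have [Bs hBs] := slice_finite pQ sQ (@polyfun_minor K n (n + n) (column lam))
  (@minor_semi_invariant K n (n + n) (column lam)) minor_neq0.
by exists Bs => C lC hC /onQ; apply: hBs.
Qed.

(** Only the [mu] of weight [size ss] are new. For these the old sections leave finitely many
    points, and each rules out finitely many [s] because its Wronskian is not identically zero. *)
Lemma generic_points_cons ss : uniq ss -> 0 \notin ss -> generic_points ss ->
  exists s, [/\ uniq (s :: ss), 0 \notin s :: ss & generic_points (s :: ss)].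
Proof.
move=> us s0 gs.
have /boolp.choice[Bs hBs] mu : exists Bs : seq 'M[K]_(n, n + n), weight mu =
  size ss ->
    forall C, lagrangian_mx C -> in_schubert C mu -> on_hyperplanes ss C ->
    exists2 B, B \in Bs & exists2 g, g \in unitmx & C = g *m B.
  have [wl|wl] := EM (weight mu = size ss); last by exists [::].
  by have [Bs hBs] := generic_points_finite gs wl; exists Bs.
have /boolp.choice[q hq] B : exists q : {poly K}, q != 0 /\
    (row_free B -> forall s, ~~ root q s -> wronskian B s != 0).
  have [fB|fB] := EM (row_free B); last by exists 1; rewrite oner_neq0.
  by have [q q0 hq] := wronskian_neq0 fB; exists q.
(* The roots of [Q] are the values to avoid, including 0 and the old points. The new point is taken
   to be a natural number, so that it is real. *)
pose Q := (\prod_mu \prod_(B <- Bs mu) q B) * (\prod_(s <- 0 :: ss) ('X -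
  s%:C%C%:P)).
have Q0 : Q != 0.
  rewrite mulf_neq0 //.
    apply/prodf_neq0 => mu _; rewrite prodf_seq_neq0; apply/allP => B _ /=.
    by have [] := hq B.
  by rewrite prodf_seq_neq0; apply/allP => s _ /=; rewrite polyXsubC_eq0.
have [k _] := nonroot_nat Q0 0; rewrite /Q rootM negb_or => /andP[kq kss].
exists k%:R.
have : k%:R \notin 0 :: ss.
  apply: contra kss => kss; rewrite /root horner_prod prodf_seq_eq0.
  apply/hasP; exists k%:R => //=.
  by rewrite hornerXsubC rmorph_nat subrr.
rewrite inE negb_or => /andP[k0 kss']; split; rewrite /= ?kss' //.
  by rewrite inE negb_or eq_sym k0.
move=> mu C lC hC; rewrite /= ltnS => le onC.
have onC' : on_hyperplanes ss C by move=> s ss_s; apply: onC;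
  rewrite inE ss_s orbT.
move: le; rewrite leq_eqVlt => /orP[/eqP wmu|lt]; last exact: (gs mu C).
have [B BBs [g ug CB]] := hBs mu wmu C lC hC onC'.
have fB : row_free B.
  by have [fC _] := lC; rewrite -row_leq_rank; move: fC;
    rewrite CB -row_leq_rank eqmxMfull // row_full_unit.
have : wronskian C k%:R%:C%C = 0 by apply: onC; rewrite mem_head.
rewrite CB wronskian_semi_invariant => /eqP; rewrite mulf_eq0 => /orP[|].
  by apply/negP; rewrite -unitfE -unitmxE.
apply/negP; rewrite rmorph_nat; apply: (hq B).2 => //.
apply: contra kq => kB; rewrite /root horner_prod; apply/prodf_eq0;
  exists mu => //.
by rewrite horner_prod prodf_seq_eq0; apply/hasP; exists B.
Qed.

Lemma exists_generic_points r :
  exists ss, [/\ size ss = r, uniq ss, 0 \notin ss & generic_points ss].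
Proof.
elim: r => [|r [ss [<- us s0 gs]]]; first by exists [::].
by have [s [? ? ?]] := generic_points_cons us s0 gs; exists (s :: ss).
Qed.

Lemma cell_mx_ext (lam : {set 'I_n}) (e e' : nat -> K) :
  (forall i, (i < n * n)%N -> e i = e' i) -> cell_mx b lam e = cell_mx b lam e'.
Proof.
move=> ee'; apply/matrixP => k j; rewrite !mxE; congr (_ + _);
  apply: eq_bigr => m _.
congr (_ * _ * _); rewrite /parameter; case: ifP => _ //; apply: ee'.
have lt (p q : 'I_n) : (p * n + q < n * n)%N.
  rewrite (@leq_trans (p * n + n)%N) ?ltn_add2l // -mulSnr leq_mul2r ltn_ord
    orbT //.
by [].
Qed.

Lemma cell_lagrangian lam (e : nat -> K) : lagrangian_mx (cell_mx b lam e).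
Proof.
split; last exact: cell_mx_isotropic.
by apply: (@minor_row_free _ _ _ (column lam)); rewrite minor_cell_mx oner_neq0.
Qed.

Lemma cell_in_schubert lam (e : nat -> K) : in_schubert (cell_mx b lam e) lam.
Proof. by rewrite -{2}(low_positions_cell_mx b lam e);
  exact: in_schubert_low. Qed.

Definition cell_variables lam : seq nat :=
  [seq (p.1 * n + p.2)%N | p : 'I_n * 'I_n <-
    enum [set p : 'I_n * 'I_n | (p.1 \in lam) && (p.2 <= p.1)%N]].

Lemma cell_variablesP lam i : reflect
  (exists k l : 'I_n, [/\ k \in lam, (l <= k)%N & i = (k * n + l)%N]) (i \in
    cell_variables lam).
Proof.
apply: (iffP mapP) => [[[k l]]|[k [l [kl lk ->]]]].
  by rewrite mem_enum inE => /andP[kl lk] ->; exists k, l.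
by exists (k, l); rewrite // mem_enum inE kl.
Qed.

Lemma cell_variables_lt lam i : i \in cell_variables lam -> (i < n * n)%N.
Proof.
move=> /cell_variablesP[k [l [_ _ ->]]].
rewrite (@leq_trans (k * n + n)%N) ?ltn_add2l // -mulSnr leq_mul2r ltn_ord orbT
  //.
Qed.

Lemma cell_variables_uniq lam : uniq (cell_variables lam).
Proof.
rewrite map_inj_uniq ?enum_uniq // => -[k l] [k' l'] /= eq.
have n0 : (0 < n)%N by exact: leq_ltn_trans (ltn_ord k).
have := congr1 (divn^~ n) eq; have := congr1 (modn^~ n) eq.
rewrite /= !modnMDl !modn_small // !divnMDl // !divn_small // !addn0.
by move=> /val_inj -> /val_inj ->.
Qed.

Lemma size_cell_variables lam : size (cell_variables lam) = weight lam.
Proof.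
rewrite size_map -cardE -sum1_card /weight.
rewrite (eq_bigl (fun p : 'I_n * 'I_n => (p.1 \in lam) && (p.2 <= p.1)%N));
  last first.
  by move=> p; rewrite inE.
rewrite -(pair_big_dep (mem lam) (fun k l : 'I_n => l <= k)%N (fun _ _ => 1%N))
  /=.
apply: eq_bigr => k _; under eq_bigl do rewrite -ltnS.
by rewrite -(big_ord_widen n (fun=> 1%N) (ltn_ord k)) big_const_ord iter_addn_0
  mul1n.
Qed.

Lemma cell_mx_parameter lam (e : nat -> K) (k l : 'I_n) : k \in lam -> (l <=
  k)%N ->
  e (k * n + l)%N = (b (column lam k))^-1 * cell_mx b lam e k (rev_ord (column
    lam l)).
Proof.
move=> kl lk; rewrite cell_mx_rev mulKf // /parameter.
have [le|_] := leqP k l; last by rewrite kl.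
by have <- : k = l; [apply/val_inj/anti_leq; rewrite le | rewrite kl].
Qed.

(* If the intersection were empty, the ratios of the hyperplane sections would
   define a map from the cell to an affine space of smaller dimension, and the
   fibres of this map would be finite. *)
Lemma generic_points_nonempty ss lam : generic_points ss -> weight lam = size ss
  ->
  (0 < size ss)%N -> exists C, [/\ lagrangian_mx C, in_schubert C lam &
    on_hyperplanes ss C].
Proof.
move=> gs wl ss0; apply: contrapT => empty.
pose Q (j : 'I_(size ss)) C := wronskian C (nth 0 ss j)%:C%C.
have pQ j : polyfun (@mxentry K n (n + n)) (Q j) by exact: polyfun_wronskian.
have sQ j : semi_invariant (Q j) by exact: wronskian_semi_invariant.
have Q_neq0 C : lagrangian_mx C -> in_schubert C lam -> ~ forall j, Q j C = 0.
  move=> lC hC QC; apply: empty; exists C; split=> // s /(nthP 0)[j js <-].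
  exact: (QC (Ordinal js)).
pose q j (e : nat -> K) := Q j (cell_mx b lam e).
have pq j : polyfun (@coordinate K) (q j).
  by apply: polyfun_comp (pQ j) => v [k [l ->]]; exact: polyfun_cell_mx.
pose lx := cell_variables lam; pose e0 : nat -> K := fun=> 0.
(* The section [i] will be the denominator of the ratios; if none were generically nonzero, all
   would vanish at a common point of the cell. *)
have [i Gi] : exists i, generic lx (fun e => q i e <> 0) e0.
  apply: contrapT => nG.
  have G0 i : generic lx (fun e => q i e = 0) e0.
    have [|nGi] := generic_dichotomy lx e0 (constr_eq0 (pq i)); first by [].
    by case: nG; exists i.
  have [e _ q0] := generic_ex (generic_all (s := enum 'I_(size ss)) (fun i _ =>
    G0 i)).
  apply: (Q_neq0 (cell_mx b lam e)); [exact: cell_lagrangian | exact: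
    cell_in_schubert |].
  by move=> j; apply: q0; rewrite mem_enum.
(* The ratio variables lie beyond the [n * n] indices used by the parameters of the cell. *)
pose y (j : 'I_(size ss)) := (n * n + j)%N.
have y_inj : injective y by move=> j k /addnI/val_inj.
pose ly := [seq y j | j <- enum (predC1 i)].
have ly_uniq : uniq ly by rewrite map_inj_uniq // enum_uniq.
have lxy k : k \in ly -> k \notin lx.
  by move=> /mapP[j _ ->]; apply/negP => /cell_variables_lt;
    rewrite ltnNge leq_addr.
pose G e := q i e <> 0 /\ forall j, j \in enum (predC1 i) -> q j e = e (y j) * q
  i e.
have cG : constr G.
  apply: constr_and; first exact/constr_not/constr_eq0.
  apply: (constr_all (P := fun j e => q j e = e (y j) * q i e) (enum (predC1
    i))) => j.
  by apply: constr_eq => //; apply: polyfun_mul => //; exact: polyfun_coord.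
have [r rE] : exists r, size ss = r.+1 by case: (size ss) ss0 => // r; exists r.
have slx : size lx = r.+1 by rewrite size_cell_variables wl.
have sly : size ly = r.
  by rewrite size_map -cardE; apply/eqP; rewrite cardC1 card_ord -eqSS prednK //
    rE.
have uxy : uniq (lx ++ ly).
  by rewrite cat_uniq cell_variables_uniq ly_uniq andbT; apply/hasPn => k /lxy.
apply: (@no_dropP K r lx ly G e0 uxy slx sly cG); last first.
  apply: generic_mono Gi => e _ qe.
  pose e' k := if k \in ly then
    (if insub (k - n * n)%N is Some j then q j e else 0) / q i e else e k.
  have cell_e : cell_mx b lam e' = cell_mx b lam e.
    apply: cell_mx_ext => k kn; rewrite /e'; case: ifP => // /mapP[j _ kj].
    by move: kn; rewrite kj ltnNge leq_addr.
  exists e' => [k kly|]; first by rewrite /e' (negPf kly).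
  rewrite /G /q cell_e; split=> // j ji.
  rewrite /e' map_f // addKn (valK j) divfK //; exact/eqP.
move=> e e0e.
(* The equations of a fibre: all ratios to [Q i] are prescribed. If [Q i] vanished on the fibre, so
   would every section, which emptiness forbids; hence [Q i] can serve as the nonvanishing function
   in [slice_finite]. *)
pose Q' j C := if j == i then 0 else Q j C - e (y j) * Q i C.
have pQ' j : polyfun (@mxentry K n (n + n)) (Q' j).
  rewrite /Q'; case: eqP => _; first exact: polyfun_cst.
  by apply: polyfun_sub => //; apply: polyfun_mul => //; exact: polyfun_cst.
have sQ' j : semi_invariant (Q' j).
  move=> g C; rewrite /Q'; case: eqP => _; first by rewrite mulr0.
  by rewrite !sQ mulrBr mulrCA.
have Q'i C : lagrangian_mx C -> in_schubert C lam -> (forall j, Q' j C = 0) -> Q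
  i C != 0.
  move=> lC hC Q'C; apply/eqP => QiC; apply: (Q_neq0 C) => // j.
  by have := Q'C j; rewrite /Q' QiC mulr0 subr0; case: eqP => [->|].
have [Bs hBs] := slice_finite pQ' sQ' (pQ i) (sQ i) Q'i.
exists [seq (b (column lam p.1))^-1 *
    (invmx (colsub (column lam) B) *m B) p.1 (rev_ord (column lam p.2)) |
    B <- Bs, p <- enum {: 'I_n * 'I_n}] => e' ee' [qe' Ge'] k.
have [|||B BBs [g ug cellE]] := hBs (cell_mx b lam e').
- exact: cell_lagrangian.
- exact: cell_in_schubert.
- move=> j; rewrite /Q'; case: eqP => // /eqP ji.
  rewrite ee' ?[Q j _]Ge' ?subrr //; first by rewrite mem_enum.
  by apply: lxy; rewrite map_f // mem_enum.
move=> /cell_variablesP[l [m [ll ml ->]]]; apply/allpairsP; exists (B, (l, m)).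
split; rewrite ?mem_enum //= (cell_mx_parameter e' ll ml).
congr (_ * fun_of_matrix _ _ _).
have := colsub_cell_mx b lam e'; rewrite cellE -mulmx_colsub => gB.
have uB : colsub (column lam) B \in unitmx.
  by have := mulmx1_unit gB => -[].
by rewrite -{1}[g](mulmxK uB) gB mul1mx.
Qed.

End Slices.

(** * Real Lagrangian subspaces *)

Section RealPolynomials.
Variable R : realType.
Implicit Types (p q u w f g : {poly R}) (a t : R).

Lemma square_deriv_le p w a t : p^`() = w * w -> a < t -> p.[a] <= p.[t].
Proof.
move=> dp at_; have [c _ mvt] := poly_mvt p at_.
rewrite -subr_ge0 mvt dp hornerM; apply: mulr_ge0; last by rewrite subr_ge0 ltW.
by rewrite -expr2 sqr_ge0.
Qed.

(** A monotone polynomial with equal end values is constant in between; the points [x i] then give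
    more roots than its degree allows. *)
Lemma square_deriv_eq p w a t : p^`() = w * w -> a < t -> p.[a] = p.[t] -> w =
  0.
Proof.
move=> dp at_ eq_at; pose q := p - p.[a]%:P.
suff q0 : q = 0.
  have : p^`() = 0.
    by rewrite -[p](subrK p.[a]%:P) -/q q0 add0r derivC.
  by rewrite dp => /eqP; rewrite mulf_eq0 orbb => /eqP.
apply/eqP; apply: contraT => q0.
pose x i := a + (t - a) / i.+2%:R.
have := max_poly_roots q0 (rs := [seq x i | i <- iota 0 (size q)]).
have ta0 : t - a != 0 by rewrite subr_eq0 gt_eqF.
rewrite size_map size_iota ltnn map_inj_uniq ?iota_uniq; last first.
  move=> i j /addrI/(mulfI ta0)/invr_inj/eqP; rewrite eqr_nat => /eqP.
  by case.
suff -> : all (root q) [seq x i | i <- iota 0 (size q)] by move/(_ isT isT).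
apply/allP => _ /mapP[i _ ->]; rewrite /root hornerD hornerN hornerC subr_eq0.
have ta : 0 < t - a by rewrite subr_gt0.
have ax : a < x i by rewrite ltrDl divr_gt0.
have xt : x i < t.
  by rewrite -ltrBrDl ltr_pdivrMr // ltr_pMr // ltr1n.
by rewrite eq_le {1}eq_at !(square_deriv_le dp).
Qed.

(* The pairs (i, j) contribute to [Q k] the integral of [u i * u j] from
   [max (s i) (s j)], so that [Q k] measures the integral of the square of a
   piecewise polynomial function. *)
Lemma orthogonal_pieces m (s : nat -> R) (u : nat -> {poly R})
    (P : nat -> nat -> {poly R}) :
  (forall i j, (i < j < m)%N -> s i < s j) ->
  (forall i j, (i < m)%N -> (j < m)%N -> (P i j)^`() = u i * u j) ->
  (forall i j, (i < m)%N -> (j < m)%N -> (P i j).[s i] = 0 /\ (P i j).[s j] = 0)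
    ->
  \sum_(i < m) \sum_(j < m) P i j = 0 -> \sum_(i < m) u i = 0 ->
  forall i, (i < m)%N -> u i = 0.
Proof.
move=> s_lt dP P0 Q0 W0.
pose Q k := \sum_(i < k) \sum_(j < k) P i j; pose W k := \sum_(i < k) u i.
have dQ k : (k <= m)%N -> (Q k)^`() = W k * W k.
  move=> km; rewrite /Q linear_sum mulr_suml; apply: eq_bigr => i _.
  rewrite linear_sum mulr_sumr; apply: eq_bigr => j _ /=.
  by rewrite dP // (leq_trans _ km).
have QS k : (k < m)%N -> (Q k.+1).[s k] = (Q k).[s k].
  move=> km; rewrite /Q big_ord_recr hornerD /= !horner_sum.
  rewrite [X in _ + X]big1 ?addr0 => [|j _].
    apply: eq_bigr => i _; rewrite big_ord_recr hornerD /=.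
    by have [_ ->] := P0 i k (ltn_trans (ltn_ord i) km) km; rewrite addr0.
  by have [-> _] := P0 k j km (leq_trans (ltn_ord j) km).
(* The values of [Q k.+1] at [s k] do not decrease with [k], and they are 0 at the first and last
   points. So all are 0, and the square has zero integral over each interval. *)
have V0 : (0 < m)%N -> (Q 1%N).[s 0%N] = 0.
  by move=> m0; rewrite /Q !big_ord1; have [] := P0 0%N 0%N m0 m0.
have V_le k : (k.+1 < m)%N -> (Q k.+1).[s k] <= (Q k.+2).[s k.+1].
  move=> km; rewrite (QS _ km); apply: (square_deriv_le (dQ _ (ltnW km))).
  by apply: s_lt; rewrite ltnSn km.
have V_ge0 k : (k < m)%N -> 0 <= (Q k.+1).[s k].
  elim: k => [|k IH] km; first by rewrite V0.
  exact: le_trans (IH (ltnW km)) (V_le k km).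
have V_eq0 k : (k < m)%N -> (Q k.+1).[s k] = 0.
  move=> km; apply/eqP; rewrite eq_le V_ge0 // andbT.
  have [d mE] : exists d, m = (k.+1 + d)%N by exists (m - k.+1)%N;
    rewrite subnKC.
  elim: d k km mE => [|d IH] k km mE; first by rewrite -[k.+1]addn0 -mE /Q Q0
    horner0.
  have k1m : (k.+1 < m)%N by rewrite mE addnS ltnS leq_addr.
  by rewrite (le_trans (V_le k k1m)) // IH // mE addnS.
have Wk k : (k <= m)%N -> W k = 0.
  case: k => [|k] km; first by rewrite /W big_ord0.
  move: km; rewrite leq_eqVlt => /orP[/eqP ->|km]; first exact: W0.
  have lt : s k < s k.+1 by apply: s_lt; rewrite ltnSn km.
  apply: (square_deriv_eq (dQ _ (ltnW km)) lt).
  by rewrite -(QS _ km) !V_eq0 // ltnW.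
move=> i im; have := Wk i.+1 im; rewrite /W big_ord_recr /= -/(W i) Wk ?add0r
  //.
exact: ltnW.
Qed.

Section Pairing.
Variable n : nat.

(* For [f] vanishing to order [n] at [a] and [g] to order [n] at [t], the
   invariant form of [f] and [g] is up to sign the integral of
   [f^`(n) * g^`(n)] between [a] and [t]; [primitive f g] is the antiderivative
   given by iterated integration by parts. *)
Definition primitive f g : {poly R} :=
  \sum_(k < n) (-1) ^+ k *: (f^`(n - k.+1) * g^`(n + k)).

Definition invariant_form f g : {poly R} :=
  \sum_(k < n + n) (-1) ^+ k *: (f^`(k) * g^`(n + n - k.+1)).

Lemma derivn_small f : (size f <= n + n)%N -> f^`(n + n) = 0.
Proof. by move=> sf; rewrite derivn_poly0. Qed.

Lemma deriv_primitive f g : (size g <= n + n)%N -> (primitive f g)^`() = f^`(n)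
  * g^`(n).
Proof.
move=> sg; pose v k := (-1) ^+ k *: (f^`(n - k) * g^`(n + k)).
have step (k : 'I_n) : ((-1) ^+ k *: (f^`(n - k.+1) * g^`(n + k)))^`() = v k - v
  k.+1.
  rewrite linearZ /= derivM -!derivnS subnSK // -addnS /v exprS mulN1r scaleNr
    opprK.
  by rewrite scalerDr.
rewrite /primitive linear_sum /=; under eq_bigr => k _ do rewrite step.
rewrite -(big_mkord xpredT (fun k => v k - v k.+1)) -[LHS]opprK -sumrN.
under eq_bigr => k _ do rewrite opprB.
rewrite telescope_sumr // opprB /v subnn subn0 addn0 derivn_small // mulr0
  scaler0 subr0.
by rewrite scale1r.
Qed.

Lemma primitive_left f g a : vanishes n f a -> (primitive f g).[a] = 0.
Proof.
move=> fa; rewrite horner_sum big1 // => k _; rewrite hornerZ hornerM fa ?mul0r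
  ?mulr0 //.
by have := ltn_ord k; lia.
Qed.

Lemma deriv_invariant_form f g : (size f <= n + n)%N -> (size g <= n + n)%N ->
  (invariant_form f g)^`() = 0.
Proof.
move=> sf sg; pose v k := (-1) ^+ k *: (f^`(k) * g^`(n + n - k)).
have step (k : 'I_(n + n)) :
    ((-1) ^+ k *: (f^`(k) * g^`(n + n - k.+1)))^`() = v k - v k.+1.
  rewrite linearZ /= derivM -!derivnS subnSK // /v exprS mulN1r scaleNr opprK.
  by rewrite addrC scalerDr.
rewrite /invariant_form linear_sum /=; under eq_bigr => k _ do rewrite step.
rewrite -(big_mkord xpredT (fun k => v k - v k.+1)) -[LHS]opprK -sumrN.
under eq_bigr => k _ do rewrite opprB.
rewrite telescope_sumr // opprB /v subnn subn0 !derivn_small //.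
by rewrite mulr0 mul0r !scaler0 subrr.
Qed.

Lemma invariant_form_cst f g a t : (size f <= n + n)%N -> (size g <= n + n)%N ->
  (invariant_form f g).[a] = (invariant_form f g).[t].
Proof.
move=> sf sg; have d0 := deriv_invariant_form sf sg.
have [c ->] : exists c, invariant_form f g = c%:P; last by rewrite !hornerC.
exists (invariant_form f g)`_0; apply/polyP => -[|i]; rewrite coefC //=.
have := congr1 (fun p : {poly R} => p`_i) d0; rewrite coef_deriv coef0 => /eqP.
by rewrite mulrn_eq0 => /eqP.
Qed.

(** Terms in which [g] is differentiated fewer than [n] times vanish at [t]; the remaining ones are
    those of [primitive] in reverse order, whence the sign. *)
Lemma invariant_form_right f g t : vanishes n g t ->
  (invariant_form f g).[t] = (-1) ^+ n.-1 * (primitive f g).[t].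
Proof.
move=> gt; rewrite /invariant_form /primitive !horner_sum big_split_ord /=.
rewrite [X in _ + X]big1 ?addr0 => [|k _]; last first.
  rewrite hornerZ hornerM gt ?mulr0 //; have := ltn_ord k; lia.
rewrite (reindex_inj rev_ord_inj) mulr_sumr; apply: eq_bigr => k _ /=.
rewrite !hornerZ !hornerM [RHS]mulrA; congr (_ * (_ * _)).
  rewrite -signr_odd -[in RHS]exprD -[in RHS]signr_odd; congr (_ ^+ _).
  have -> : (n.-1 + k = (n - k.+1) + (k + k))%N by have := ltn_ord k; lia.
  by rewrite oddD addnn odd_double addbF.
by congr (_^`(_)).[_]; have := ltn_ord k; lia.
Qed.

(** [primitive (h a) (h t)] vanishes at [a] by its shape and at [t] by orthogonality, so
    [orthogonal_pieces] applies to the n-th derivatives. A polynomial vanishing to order [n]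
    somewhere with zero n-th derivative is zero. *)
Lemma orthogonal_independent (pts : seq R) (h : R -> {poly R}) : uniq pts ->
  (forall a, a \in pts -> vanishes n (h a) a) ->
  (forall a, a \in pts -> (size (h a) <= n + n)%N) ->
  (forall a t, a \in pts -> t \in pts -> (invariant_form (h a) (h t)).[0] = 0)
    ->
  \sum_(a <- pts) h a = 0 -> forall a, a \in pts -> h a = 0.
Proof.
move=> u_pts van sz orth sum0.
pose ps := sort <=%O pts.
have ps_lt : sorted <%O ps by rewrite sort_lt_sorted.
have mem_ps a : (a \in ps) = (a \in pts) by rewrite mem_sort.
pose m := size ps; pose s i := nth 0 ps i.
have s_pts i : (i < m)%N -> s i \in pts by move=> im; rewrite -mem_ps mem_nth.
have sumE (F : R -> {poly R}) : \sum_(i < m) F (s i) = \sum_(a <- pts) F a.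
  by rewrite -(perm_big _ (permEl (perm_sort <=%O pts))) (big_nth 0) big_mkord.
have dvd0 a : a \in pts -> (h a)^`(n) = 0 -> h a = 0.
  move=> apts d0; apply/eqP; apply: contraT => h0.
  have := dvdp_leq h0 (vanishes_dvdp (van a apts));
    rewrite size_exp_XsubC => ns.
  have /eqP := congr1 (fun p : {poly R} => p`_((size (h a)).-1 - n)) d0.
  rewrite coef_derivn coef0 subnKC; last by rewrite -ltnS prednK // (leq_trans _
    ns).
  rewrite mulrn_eq0 -lead_coefE lead_coef_eq0 (negPf h0) orbF -leqn0 leqNgt
    ffact_gt0.
  by rewrite -ltnS prednK ?ns // (leq_trans _ ns).
have primitive_sum k (F : 'I_k -> {poly R}) g :
    \sum_i primitive (F i) g = primitive (\sum_i F i) g.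
  rewrite /primitive exchange_big; apply: eq_bigr => l _ /=.
  by rewrite -scaler_sumr -mulr_suml linear_sum.
suff u0 i : (i < m)%N -> (h (s i))^`(n) = 0.
  move=> a apts; apply: dvd0 => //.
  have aps : a \in ps by rewrite mem_ps.
  by rewrite -(nth_index 0 aps) u0 // index_mem.
apply: (@orthogonal_pieces m s (fun i => (h (s i))^`(n))
  (fun i j => primitive (h (s i)) (h (s j)))).
- by move=> {}i j /andP[ij jm]; rewrite lt_sorted_ltn_nth // inE (ltn_trans ij).
- by move=> {}i j im jm; rewrite deriv_primitive // sz // s_pts.
- move=> {}i j im jm; split; first exact/primitive_left/van/s_pts.
  have [si sj] := (s_pts i im, s_pts j jm).
  have := orth _ _ si sj; rewrite (invariant_form_cst 0 (s j)) ?sz //.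
  rewrite (invariant_form_right _ (van _ sj)) => /eqP.
  by rewrite mulf_eq0 signr_eq0 => /eqP.
- rewrite exchange_big big1 // => j _ /=; rewrite primitive_sum (sumE h) sum0.
  by rewrite /primitive big1 // => k _; rewrite linear0 mul0r scaler0.
- by rewrite -linear_sum (sumE h) sum0 linear0.
Qed.

End Pairing.

End RealPolynomials.

(** * Nonexistence of real points *)

Section NoRealPoint.
Variables (R : realType) (n : nat).
Let K := R[i].
Notation cplx := (map_mx (real_complex R)).

Lemma horner0_derivn (F : comNzRingType) (p : {poly F}) k : p^`(k).[0] = p`_k *+
  k`!.
Proof. by rewrite horner_coef0 coef_derivn addn0 ffactnn. Qed.

(** The coefficients of [invariant_form] at 0 on coefficient vectors; the scalar [c] absorbs a
    constant that depends on the curve. *)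
Definition invariant_coef (c : K) (k : 'I_(n + n)) : K :=
  c * ((-1) ^+ k * (k`! * (n + n - k.+1)`!)%:R).

Lemma invariant_coef_neq0 c : c != 0 -> forall k, invariant_coef c k != 0.
Proof.
move=> c0 k; rewrite mulf_neq0 // mulf_neq0 ?signr_eq0 // pnatr_eq0 muln_eq0.
by rewrite negb_or -!lt0n !fact_gt0.
Qed.

Lemma invariant_coef_rev c k : invariant_coef c (rev_ord k) = - invariant_coef c
  k.
Proof.
rewrite /invariant_coef -mulrN; congr (_ * _); rewrite -mulNr.
have kn := ltn_ord k; have -> : (n + n - (rev_ord k).+1 = k)%N by rewrite /=;
  lia.
rewrite mulnC; congr (_ * _%:R).
rewrite -signr_odd -[in RHS]signr_odd /= oddB // oddD addbb /=.
by case: (odd k); rewrite /= ?expr0 ?expr1 ?opprK.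
Qed.

Lemma invariant_form_mx c (u w : 'rV[R]_(n + n)) :
  (cplx u *m form_mx (invariant_coef c) *m (cplx w)^T) 0 0 =
  c * ((invariant_form n (rVpoly u) (rVpoly w)).[0])%:C%C.
Proof.
rewrite form_mxE /invariant_form horner_sum rmorph_sum mulr_sumr;
  apply: eq_bigr => k _.
rewrite hornerZ hornerM !horner0_derivn coef_rVpoly_ord /invariant_coef.
have -> : (n + n - k.+1)%N = rev_ord k by [].
rewrite coef_rVpoly_ord -(mulr_natr _ k`!) -(mulr_natr _ (rev_ord k)`!) natrM.
rewrite !rmorphM rmorphXn rmorphN1 !rmorph_nat !mxE /=.
set x := (u 0 k)%:C%C; set y := (w 0 _)%:C%C.
rewrite -!mulrA; congr (_ * (_ * _)).
by rewrite [RHS]mulrCA; congr (_ * _); rewrite [LHS]mulrC -mulrA.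
Qed.

Lemma real_part_row (v : 'rV[K]_(n + n)) :
  let x := map_mx (@complex.Re R) v in let y := map_mx (@complex.Im R) v in
  [/\ v = cplx x + 'i *: cplx y, 2 *: cplx x = v + map_mx (@conjc R) v
    & (2 * 'i) *: cplx y = v - map_mx (@conjc R) v].
Proof.
split; apply/rowP => j; rewrite !mxE.
- by rewrite [LHS]complexE.
- rewrite mulr_natl mulr2n; case: (v 0 j) => a d.
  by apply/eqP; rewrite eq_complex /= addr0 subrr !eqxx.
- rewrite -mulrA mulr_natl mulr2n; case: (v 0 j) => a d; apply/eqP.
  by rewrite eq_complex /= !(mul0r, mul1r, mulr0) opprK !(subrr, addr0, add0r)
    !eqxx.
Qed.

(** Stability under conjugation puts the real and imaginary parts in [C]. Both vanish to the same
    order because [s] is real, and one of them is nonzero. *)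
Lemma real_vanishing_row (C : 'M[K]_(n, n + n)) (s : R) :
  (forall w : 'rV[K]_(n + n), (w <= C)%MS -> (map_mx (@conjc R) w <= C)%MS) ->
  row_free C -> wronskian C s%:C%C = 0 ->
  exists w : 'rV[R]_(n + n), [/\ w != 0, (cplx w <= C)%MS & vanishes n (rVpoly
    w) s].
Proof.
move=> realC fC /(wronskian_eq0P _ fC)[v [v0 vC van]].
have [vE xE yE] := real_part_row v; set x := map_mx _ v in vE xE;
  set y := map_mx _ v in vE yE.
have xC : (cplx x <= C)%MS.
  have : (2 *: cplx x <= C)%MS by rewrite xE addmx_sub // realC.
  by rewrite eqmx_scale // pnatr_eq0.
have yC : (cplx y <= C)%MS.
  have : ((2 * 'i) *: cplx y <= C)%MS by rewrite yE addmx_sub // eqmx_opp realC.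
  by rewrite eqmx_scale // mulf_neq0 ?pnatr_eq0 // neq0Ci.
have van_xy k : (k < n)%N -> (rVpoly x)^`(k).[s] = 0 /\ (rVpoly y)^`(k).[s] = 0.
  move=> /van; rewrite vE linearD linearZ /= derivnD derivnZ hornerD hornerZ.
  rewrite -!map_rVpoly !derivn_map !horner_map /= => /eqP.
  have -> (a d : R) : a%:C%C + 'i * d%:C%C = (a +i* d)%C by rewrite
    [RHS]complexE.
  by rewrite eq_complex /= => /andP[/eqP -> /eqP ->].
have [x0|x0] := eqVneq x 0; last by exists x; split=> // k /van_xy[].
exists y; split=> // [|k /van_xy[]//]; apply: contra_neq v0 => y0.
by rewrite vE x0 y0 map_mx0 scaler0 addr0.
Qed.

(** Equality would make every part equal to 1, and distinct parts allow only one such part. *)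
Lemma card_lt_weight (lam : {set 'I_n}) : (1 < weight lam)%N -> (#|lam| < weight
  lam)%N.
Proof.
move=> w1; have le : (#|lam| <= weight lam)%N by rewrite -sum1_card leq_sum.
rewrite ltn_neqAle le andbT; apply: contraTneq w1 => eq.
have /leqif_sum eqs : forall k : 'I_n, k \in lam -> (1 <= k.+1 ?= iff (k == 0 :>
  nat))%N.
  by move=> k _; split=> //; rewrite eqSS eq_sym.
have : (#|lam| == weight lam) by rewrite eq.
rewrite -sum1_card /weight eqs => /forall_inP all0.
suff : (#|lam| <= 1)%N by rewrite eq -leqNgt.
apply/card_le1_eqP => k l kl ll.
by apply/val_inj; rewrite /= (eqP (all0 k kl)) (eqP (all0 l ll)).
Qed.

(* A real Lagrangian subspace in position [lam] contains [size ss] vectors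
   vanishing at the points of [ss] and a space of codimension [#|lam| < size ss]
   of vectors vanishing at [0], hence a nontrivial relation between vectors
   vanishing at distinct points, against [orthogonal_independent]. *)
Lemma no_real_point (c : K) (ss : seq R) (lam : {set 'I_n}) (C : 'M[K]_(n, n +
  n)) :
  c != 0 -> lagrangian_mx (invariant_coef c) C -> low_positions C = lam ->
  (1 < weight lam)%N -> weight lam = size ss -> uniq ss -> 0 \notin ss ->
  on_hyperplanes ss C ->
  ~ (forall w : 'rV[K]_(n + n), (w <= C)%MS -> (map_mx (@conjc R) w <= C)%MS).
Proof.
move=> c0 [fC isoC] lowC w1 wl us s0 onC realC.
have /boolp.choice[W hW] a : exists w : 'rV[R]_(n + n), a \in ss ->
    [/\ w != 0, (cplx w <= C)%MS & vanishes n (rVpoly w) a].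
  have [ass|] := boolP (a \in ss); last by exists 0.
  by have [w hw] := real_vanishing_row realC fC (onC a ass); exists w.
pose M : 'M[R]_(size ss, #|lam|) := \matrix_(i, q) W (nth 0 ss i) 0 (lo
  (enum_val q)).
have [d d0 dM] : exists2 d : 'rV[R]_(size ss), d != 0 & d *m M = 0.
  have : kermx M != 0.
    rewrite kermx_eq0 -row_leq_rank -ltnNge (leq_ltn_trans (rank_leq_col _)) //.
    by rewrite -wl card_lt_weight.
  by case/rowV0Pn => d /sub_kermxP dM d0; exists d.
pose g : 'rV[R]_(n + n) := \sum_i d 0 i *: W (nth 0 ss i).
have gC : (cplx g <= C)%MS.
  rewrite /g raddf_sum /=; apply: summx_sub => i _.
  rewrite map_mxZ; apply: scalemx_sub.
  by have [] := hW (nth 0 ss i) (mem_nth 0 (ltn_ord i)).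
(* The kernel vector [d] gives the entries at the [lo] indices of [lam], and [low_vanish] gives the
   others; so [g] vanishes to order [n] at 0. *)
have g_lo k : g 0 (lo k) = 0.
  suff /eqP : cplx g 0 (lo k) = 0 by rewrite mxE fmorph_eq0 => /eqP.
  apply: (@low_vanish _ n C _ 0) => // l ll _.
  rewrite mxE; apply/eqP; rewrite fmorph_eq0; apply/eqP.
  rewrite lowC in ll.
  have /matrixP/(_ 0 (enum_rank_in ll l)) := dM; rewrite !mxE => <-.
  rewrite /g summxE; apply: eq_bigr => i _; rewrite !mxE.
  by rewrite enum_rankK_in.
pose cf a := if insub (index a ss) is Some i then d 0 i else 0.
have cf_nth (i : 'I_(size ss)) : cf (nth 0 ss i) = d 0 i.
  by rewrite /cf index_uniq // (valK i).
pose hv a := if a == 0 then - g else cf a *: W a.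
have hv_nth (i : 'I_(size ss)) : hv (nth 0 ss i) = d 0 i *: W (nth 0 ss i).
  rewrite /hv cf_nth; case: eqP => // e; case/negP: s0.
  by rewrite -e mem_nth.
have hvC a : a \in 0 :: ss -> (cplx (hv a) <= C)%MS.
  rewrite inE /hv; case: eqP => [_ _|_ /= ass].
    by rewrite map_mxN eqmx_opp.
  by rewrite map_mxZ scalemx_sub //; have [] := hW a ass.
have h0 : forall a, a \in 0 :: ss -> rVpoly (hv a) = 0.
  apply: (@orthogonal_independent R n) => /=; first by rewrite s0.
  - move=> a; rewrite inE /hv; case: eqP => [-> _|_ /= ass] k kn.
      rewrite horner0_derivn linearN coefN.
      have [l ->] : exists l : 'I_n, k = lo l.
        by exists (rev_ord (Ordinal kn)); rewrite lo_val /=; lia.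
      by rewrite coef_rVpoly_ord g_lo oppr0 mul0rn.
    rewrite linearZ /= derivnZ hornerZ; have [_ _ ->] := hW a ass => //.
    by rewrite mulr0.
  - by move=> a _; rewrite size_poly.
  - move=> a t ha ht; have /submxP[x xE] := hvC a ha;
    have /submxP[y yE] := hvC t ht.
    have := invariant_form_mx c (hv a) (hv t).
    rewrite xE yE trmx_mul !mulmxA -2!(mulmxA x) isoC mulmx0 mul0mx mxE.
    move=> /esym/eqP; rewrite mulf_eq0 (negPf c0) /= fmorph_eq0 => /eqP.
    by [].
  - rewrite big_cons (big_nth 0) big_mkord /hv eqxx -/hv.
    rewrite -linear_sum -linearD /=; rewrite (_ : - g + _ = 0) ?linear0 //.
    apply/eqP; rewrite addrC subr_eq0; apply/eqP; rewrite /g.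
    by apply: eq_bigr => i _; rewrite -[RHS]hv_nth.
case/eqP: d0; apply/rowP => i; rewrite mxE.
have iss := mem_nth 0 (ltn_ord i).
have /(congr1 (@poly_rV R (n + n))) : rVpoly (hv (nth 0 ss i)) = 0.
  by apply: h0; rewrite inE iss orbT.
rewrite rVpolyK linear0 hv_nth => /eqP; rewrite scaler_eq0.
have [w0 _ _] := hW _ iss.
by rewrite (negPf w0) orbF => /eqP.
Qed.

End NoRealPoint.

(** * Coordinates adapted to an isotropic rational normal curve *)

(* Here [m i j] stands for the pairing of the i-th and j-th derivatives of a
   polynomial curve of degree less than [N]. *)
Lemma antidiagonal_pairing (K : numFieldType) (N : nat) (m : nat -> nat -> {poly
  K}) :
  (0 < N)%N -> (forall i j, (m i j)^`() = m i.+1 j + m i j.+1) ->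
  (forall i j, m i j = - m j i) -> (forall i j, (N <= i)%N -> m i j = 0) ->
  (forall i j, (i + j + 2 <= N)%N -> m i j = 0) ->
  forall i j, m i j = if (i + j).+1 == N then (-1) ^+ i *: m 0%N N.-1 else 0.
Proof.
move=> N0 dm skew big small.
have level1 i j : (i + j).+1 = N -> m i j = (-1) ^+ i *: m 0%N N.-1.
  elim: i j => [|i IH] j ijN; first by rewrite expr0 scale1r -ijN.
  have := dm i j; rewrite small ?deriv0 => [/esym/eqP|]; last by lia.
  rewrite addr_eq0 => /eqP ->; rewrite IH; last by lia.
  by rewrite exprS mulN1r scaleNr.
(* Past the antidiagonal, entries are multiples of the derivative of [m 0 N.-1]. The entry at
   [i = N] is zero, which forces that derivative to vanish. *)
have level2 i j : (i + j)%N = N ->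
    m i j = - ((-1) ^+ i *: (m 0%N N.-1)^`() *+ i).
  elim: i j => [|i IH] j ijN.
    by rewrite skew big ?mulr0n //; lia.
  have := dm i j; rewrite level1; last by lia.
  rewrite derivZ (IH j.+1); last by lia.
  move=> /esym/(canRL (subrK _)) ->.
  by rewrite exprS mulN1r scaleNr mulNrn opprK mulrS.
have c0 : (m 0%N N.-1)^`() = 0.
  have /eqP := level2 N 0%N (addn0 N); rewrite big // eq_sym oppr_eq0
    -scaler_nat.
  by rewrite !scaler_eq0 signr_eq0 pnatr_eq0 -leqn0 leqNgt N0 => /eqP.
have level3 L i j : (i + j)%N = (N + L)%N -> m i j = 0.
  elim: L i j => [|L IH] i j ijN.
    by rewrite level2 ?c0 ?scaler0 ?mul0rn ?oppr0 // ijN addn0.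
  elim: i j ijN => [|i IHi] j ijN; first by rewrite skew big ?oppr0 //; lia.
  have := dm i j; rewrite IH ?deriv0 => [/esym/eqP|]; last by lia.
  by rewrite addr_eq0 => /eqP ->; rewrite IHi ?oppr0 //; lia.
move=> i j; case: eqP => [/level1 //|ne].
have [le|gt] := leqP (i + j + 2) N; first exact: small.
by apply: (level3 (i + j - N)%N); lia.
Qed.

Section FormMatrices.
Variables (K : fieldType) (n : nat).
Implicit Types b c : 'I_(n + n) -> K.

Lemma form_mx_trK b c : (forall j, b j * c j = 1) -> form_mx b *m (form_mx c)^T
  = 1%:M.
Proof.
move=> bc; apply/matrixP => i j; rewrite !mxE (bigD1 (rev_ord i)) //= !mxE eqxx
  mulr1n.
rewrite (inj_eq rev_ord_inj) big1 ?addr0 => [|k ki].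
  by case: eqP => [->|]; rewrite ?mulr0 // mulr1n bc.
by rewrite !mxE (negPf ki) mulr0n mul0r.
Qed.

Lemma form_mx_unit b : (forall j, b j != 0) -> form_mx b \in unitmx.
Proof.
move=> b0; have /form_mx_trK/mulmx1_unit[] // : forall j, b j * (b j)^-1 = 1.
by move=> j; rewrite divff.
Qed.

End FormMatrices.

Section SymplecticForm.
Variables (R : realType) (n : nat).
Let K := R[i].
Implicit Types (v u : 'rV[K]_(n + n)).

Definition sympl_coef (j : 'I_(n + n)) : K := if (j < n)%N then 1 else -1.

Lemma sympl_coef_neq0 j : sympl_coef j != 0.
Proof. by rewrite /sympl_coef; case: ifP; rewrite ?oppr_eq0 oner_neq0. Qed.

Definition sympl_mx : 'M[K]_(n + n) := form_mx sympl_coef.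

Lemma symplE u v : sympl u v = (u *m sympl_mx *m v^T) 0 0.
Proof.
rewrite form_mxE big_split_ord /= [X in _ + X](reindex_inj rev_ord_inj)
  -big_split /=.
apply: eq_bigr => i _; rewrite /sympl_coef /= ltn_ord mul1r ltnNge leq_addr /=.
have <- : rev_ord (lshift n i) = rshift n (rev_ord i).
  by apply: val_inj; rewrite /=; have := ltn_ord i; lia.
by rewrite rev_ordK mulN1r mulNr [_ * u 0 _]mulrC.
Qed.

Lemma sympl_skew u v : sympl u v = - sympl v u.
Proof.
rewrite /sympl -sumrN; apply: eq_bigr => i _.
by rewrite opprB [v 0 _ * _]mulrC [u 0 _ * _]mulrC.
Qed.

Lemma symplDr u v v' : sympl u (v + v') = sympl u v + sympl u v'.
Proof. by rewrite !symplE raddfD /= mulmxDr mxE. Qed.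

Lemma symplZr u a v : sympl u (a *: v) = a * sympl u v.
Proof. by rewrite !symplE linearZ /= -scalemxAr mxE. Qed.

Lemma symplDl u u' v : sympl (u + u') v = sympl u v + sympl u' v.
Proof. by rewrite !symplE !mulmxDl mxE. Qed.

Lemma symplZl a u v : sympl (a *: u) v = a * sympl u v.
Proof. by rewrite !symplE -!scalemxAl mxE. Qed.

Lemma symplvv v : sympl v v = 0.
Proof.
have /eqP := sympl_skew v v.
by rewrite -addr_eq0 -mulr2n mulrn_eq0 => /eqP.
Qed.

Lemma lagrangian_perp (H : {vspace 'rV[K]_(n + n)}) v : lagrangian H ->
  (forall u, u \in H -> sympl u v = 0) -> v \in H.
Proof.
move=> [isoH maxH] orth; suff <- : (H + <[v]>)%VS = H by rewrite memvE addvSr.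
apply: maxH; last exact: addvSl.
move=> x y /memv_addP[a aH [_ /vlineP[c ->] ->]] /memv_addP[d dH [_ /vlineP[e
  ->] ->]].
rewrite symplDl !symplDr !symplZl !symplZr symplvv !mulr0 addr0.
by rewrite isoH // orth // sympl_skew orth // oppr0 !mulr0 !addr0.
Qed.

End SymplecticForm.

Section CurveCoordinates.
Variables (R : realType) (n : nat) (gamma : (n + n).-tuple {poly_(n + n) R}).
Hypotheses (n_gt0 : (0 < n)%N) (gamma_rnc : rational_normal_curve gamma).
Hypothesis gamma_iso : forall s : R[i], isotropic_flag (osculating_flag gamma
  s).
Let K := R[i].
Implicit Types (v u : 'rV[K]_(n + n)) (s : K).
Local Notation sympl_coef := (@sympl_coef R n).
Local Notation sympl_mx := (sympl_mx R n).

Definition curve_mx : 'M[R]_(n + n) := \matrix_(j, k) (tnth gamma j : {poly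
  R})`_k.

Lemma curve_mx_unit : curve_mx \in unitmx.
Proof.
rewrite -row_free_unit -kermx_eq0; apply/rowV0P => x /sub_kermxP xG.
have /andP[_ /freeP fg] := gamma_rnc; apply/rowP => j; rewrite mxE.
apply: (fg (fun j => x 0 j)); apply/val_inj; rewrite /= raddf_sum /=;
  apply/polyP => k.
rewrite coef_sum coef0.
have [kn|kn] := ltnP k (n + n); last first.
  by rewrite big1 // => i _; rewrite coefZ big_coef_npoly ?mulr0.
have /matrixP/(_ 0 (Ordinal kn)) := xG; rewrite !mxE => xGk; rewrite -[RHS]xGk.
by apply: eq_bigr => i _; rewrite coefZ mxE (tnth_nth 0).
Qed.

Local Notation cplx := (map_mx (real_complex R)).
Local Notation G := (cplx curve_mx).

Definition coord_mx : 'M[K]_(n + n) := sympl_mx *m G.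

Lemma coord_mx_unit : coord_mx \in unitmx.
Proof.
by rewrite unitmx_mul form_mx_unit ?map_unitmx ?curve_mx_unit //;
  exact: sympl_coef_neq0.
Qed.

Definition curve_poly (j : 'I_(n + n)) : {poly K} :=
  map_poly (real_complex R) (tnth gamma j : {poly R}).
Local Notation p := curve_poly.

Lemma curve_derivativeE k s j : curve_derivative gamma k s 0 j = (p j)^`(k).[s].
Proof. by rewrite mxE. Qed.

Lemma rVpoly_coord_mx v : rVpoly (v *m coord_mx) = \sum_j (v *m sympl_mx) 0 j *:
  p j.
Proof.
rewrite mulmxA mulmx_sum_row linear_sum; apply: eq_bigr => j _.
rewrite linearZ /=; congr (_ *: _); apply/polyP => k;
  rewrite coef_rVpoly coef_map /=.
case: insubP => [i _ <-|]; first by rewrite !mxE.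
by rewrite -leqNgt => nk; rewrite big_coef_npoly ?rmorph0.
Qed.

Lemma horner_coord_mx v k s :
  (rVpoly (v *m coord_mx))^`(k).[s] = sympl v (curve_derivative gamma k s).
Proof.
rewrite rVpoly_coord_mx linear_sum /= horner_sum symplE mxE;
  apply: eq_bigr => j _.
by rewrite linearZ /= hornerZ; congr (_ * _); rewrite !mxE.
Qed.

Lemma mem_osculating_flag v i s : (n <= i <= n + n)%N ->
  (v \in osculating_flag gamma s i) <-> vanishes (n + n - i) (rVpoly (v *m
    coord_mx)) s.
Proof.
move=> /andP[ni i2n].
have [_ _ [iso_n max_n] ann] := gamma_iso s.
suff -> : (v \in osculating_flag gamma s i) <->
    (forall u, u \in osculating_flag gamma s (n + n - i) -> sympl u v = 0).
  split=> [orth k kn|van u].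
    rewrite horner_coord_mx sympl_skew orth ?oppr0 //.
    by apply/memv_span/map_f; rewrite mem_iota.
  move=> /(@coord_span _ _ _ (in_tuple _)) ->.
  rewrite sympl_skew; apply/eqP; rewrite oppr_eq0; apply/eqP.
  apply: (big_ind (fun w => sympl v w = 0)) => [|w w' w0 w0'|l _].
  - by rewrite -(scale0r 0) symplZr mul0r.
  - by rewrite symplDr w0 w0' addr0.
  rewrite symplZr; have := ltn_ord l; rewrite {2}size_map size_iota => ln.
  rewrite (nth_map 0%N) ?size_iota // nth_iota // add0n -horner_coord_mx van
    ?mulr0 //.
(* At [i = n] the annihilator description comes from the Lagrangian condition instead of the flag
   condition. *)
have [->|ni'] := eqVneq i n; last first.
  have ni2n : (n < i <= n + n)%N by rewrite ltn_neqAle eq_sym ni' ni.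
  by have /= -> := congr1 (fun S : set _ => S v) (ann i ni2n).
rewrite addnK; split=> [vF u uF|]; [exact: iso_n | exact: lagrangian_perp].
Qed.

(** ** The symplectic form in the new coordinates *)

Definition pairing i j : {poly K} :=
  \sum_l sympl_coef l *: ((p l)^`(i) * (p (rev_ord l))^`(j)).
Local Notation m := pairing.

Lemma horner_pairing i j s :
  (m i j).[s] = sympl (curve_derivative gamma i s) (curve_derivative gamma j s).
Proof.
rewrite symplE form_mxE horner_sum; apply: eq_bigr => l _.
by rewrite hornerZ hornerM mulrA !curve_derivativeE.
Qed.

Lemma poly_eval_inj (f g : {poly K}) : (forall s, f.[s] = g.[s]) -> f = g.
Proof.
move=> fg; apply/eqP; rewrite -subr_eq0; apply: contraT => /nonroot_nat/(_
  0%N)[k _].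
by rewrite /root hornerD hornerN fg subrr eqxx.
Qed.

(** For [i <= j] the j-th derivative lies in the step of dimension 2n - i - 1, the annihilator of
    the step containing the i-th. When i + 1 = n both lie in the Lagrangian step. *)
Lemma pairing_small i j : (i + j + 2 <= n + n)%N -> m i j = 0.
Proof.
move=> ijn; apply: poly_eval_inj => s; rewrite horner0 horner_pairing.
have mem_cd k l : (k < l)%N -> curve_derivative gamma k s \in osculating_flag
  gamma s l.
  by move=> kl; apply/memv_span/map_f; rewrite mem_iota.
wlog : i j ijn / (i <= j)%N => [hw|ij].
  have [ij|ji] := leqP i j; first exact: hw.
  rewrite sympl_skew hw ?oppr0 //; last exact: ltnW.
  by rewrite [(j + i)%N]addnC.
have [_ _ [iso_n _] ann] := gamma_iso s.
have [i1n|i1n] := eqVneq i.+1 n; first by apply: iso_n; apply: mem_cd; lia.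
have i2n : (n < n + n - i.+1 <= n + n)%N by lia.
have : curve_derivative gamma j s \in osculating_flag gamma s (n + n - i.+1).
  by apply: mem_cd; lia.
have /= -> := congr1 (fun S : set _ => S (curve_derivative gamma j s)) (ann _
  i2n).
by apply; apply: mem_cd; lia.
Qed.

Lemma pairing_antidiagonal i j :
  m i j = if (i + j).+1 == (n + n)%N then (-1) ^+ i *: m 0%N (n + n).-1 else 0.
Proof.
apply: antidiagonal_pairing => {i j} [|i j|i j|i j ni|]; first by lia.
- rewrite /pairing linear_sum -big_split; apply: eq_bigr => l _ /=.
  by rewrite derivZ derivM -!derivnS scalerDr.
- by apply: poly_eval_inj => s; rewrite hornerN !horner_pairing sympl_skew.
- rewrite /pairing big1 // => l _; rewrite derivn_poly0 ?mul0r ?scaler0 //.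
  by rewrite size_map_poly (leq_trans (size_npoly _)).
- exact: pairing_small.
Qed.

Definition pairing_constant : K := (m 0%N (n + n).-1).[0].
Local Notation kappa := pairing_constant.

Lemma gram_curve_mx : G^T *m sympl_mx *m G =
  form_mx (fun i => (-1) ^+ i * kappa / (i`! * (n + n - i.+1)`!)%:R).
Proof.
have fact0 k : k`!%:R != 0 :> K by rewrite pnatr_eq0 -lt0n fact_gt0.
apply/matrixP => i j; have := congr1 (horner^~ 0) (pairing_antidiagonal i j).
have -> : (m i j).[0] = i`!%:R * j`!%:R * (G^T *m sympl_mx *m G) i j.
  rewrite horner_sum.
  have -> : (G^T *m sympl_mx *m G) i j = (row i G^T *m sympl_mx *m (row j
    G^T)^T) 0 0.
    by rewrite -row_mul [LHS]mxE [RHS]mxE; apply: eq_bigr => l _; rewrite !mxE.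
  rewrite form_mxE mulr_sumr; apply: eq_bigr => l _.
  rewrite hornerZ hornerM !horner0_derivn !mxE !coef_map /=.
  have reorder (w a d : K) x y : w * ((a *+ x) * (d *+ y)) = x%:R * y%:R * (w *
    a * d).
    by rewrite -(mulr_natr a) -(mulr_natr d); ring.
  exact: reorder.
move=> key; rewrite [RHS]mxE; move: key.
have -> : ((i + j).+1 == n + n)%N = (j == rev_ord i).
  rewrite -val_eqE /=; have := ltn_ord i; have := ltn_ord j; lia.
case: eqP => [->|_] /=; last first.
  rewrite horner0 => /eqP; rewrite !mulf_eq0 (negPf (fact0 _)) (negPf (fact0 _))
    /=.
  by move/eqP => ->; rewrite mulr0n.
rewrite hornerZ -/kappa => <-; rewrite mulr1n natrM /=.
by rewrite mulrC mulKf // mulf_neq0.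
Qed.

Lemma pairing_constant_neq0 : kappa != 0.
Proof.
apply/eqP => k0; have : G^T *m sympl_mx *m G \in unitmx.
  rewrite !unitmx_mul unitmx_tr map_unitmx curve_mx_unit form_mx_unit //.
  exact: sympl_coef_neq0.
suff -> : G^T *m sympl_mx *m G = 0.
  by rewrite unitmxE; case: (n) n_gt0 => // n' _; rewrite det0 unitr0.
rewrite gram_curve_mx; apply/matrixP => i j; rewrite !mxE k0 mulr0 mul0r.
by rewrite mul0rn.
Qed.

(** The new coordinates of [v] are pairings with the curve, so the form in them is the inverse
    transpose of the Gram matrix. This turns the reciprocal factorials of [gram_curve_mx] into
    factorials and [kappa] into its inverse. *)
Lemma coord_mx_form :
  coord_mx *m form_mx (invariant_coef kappa^-1) *m coord_mx^T = sympl_mx.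
Proof.
set B := form_mx _; set E := fun i : 'I_(n + n) => (-1) ^+ i * kappa / (i`! * (n
  + n - i.+1)`!)%:R.
have BE : B *m (form_mx E)^T = 1%:M.
  apply: form_mx_trK => j; rewrite /E /invariant_coef.
  set f := _%:R; have f0 : f != 0.
    by rewrite pnatr_eq0 muln_eq0 negb_or -!lt0n !fact_gt0.
  have reorder (x y z : K) : x != 0 -> y * y = 1 -> z != 0 -> x^-1 * (y * z) *
    (y * x / z) = 1.
    by move=> x0 y2 z0; rewrite -y2; field; rewrite x0 z0.
  apply: reorder => //; last by rewrite -expr2 sqrr_sign.
  exact: pairing_constant_neq0.
have GE : G *m B *m (G^T *m sympl_mx^T *m G) = G.
  have -> : G^T *m sympl_mx^T *m G = (form_mx E)^T.
    by rewrite -gram_curve_mx !trmx_mul trmxK mulmxA.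
  by rewrite -mulmxA BE mulmx1.
have GB : G *m B *m G^T *m sympl_mx^T = 1%:M.
  have uG : G \in unitmx by rewrite map_unitmx curve_mx_unit.
  by rewrite -[LHS](mulmxK uG) -[X in X *m invmx G](_ : G = _) ?mulmxV // -[in
    LHS]GE !mulmxA.
transitivity (sympl_mx *m (G *m B *m G^T *m sympl_mx^T));
  last by rewrite GB mulmx1.
by rewrite /coord_mx trmx_mul !mulmxA.
Qed.

End CurveCoordinates.

(** * The Lagrangian Grassmannian in matrix coordinates *)

Section KrullZero.
Local Open Scope classical_set_scope.
Variable T : topologicalType.

Lemma closed_seq (s : seq T) : (forall x : T, closed [set x]) -> closed [set x |
  x \in s].
Proof.
move=> closed1; elim: s => [|x s IH].
  rewrite (_ : [set x | _] = classical_sets.set0); first exact: closed0.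
  by apply/seteqP; split.
rewrite (_ : [set y | _] = [set x] `|` [set y | y \in s]); first exact: closedU.
apply/seteqP; split=> y /=; rewrite inE.
  by case/orP=> [/eqP|]; [left|right].
by case=> [->|->]; rewrite ?eqxx ?orbT.
Qed.

(** In a chain of length 1 the larger set is covered by a point [a] of the smaller one and the
    finite closed set of other points. Irreducibility leaves it in one of these; the first
    contradicts strictness, the second omits [a]. *)
Lemma finite_has_dimension0 (X : set T) (s : seq T) : (forall x : T, closed [set
  x]) ->
  X !=set0 -> (forall x, X x -> x \in s) -> has_dimension X 0.
Proof.
move=> closed1 [x0 Xx0] Xs; split.
  exists (fun=> [set x0]); split=> // i _; split.
    exists [set x0]; first exact: closed1.
    by apply/seteqP; split=> x /= => [->|[]].
  split=> [|W1 W2 _ _ sub]; first by exists x0.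
  by case: (sub x0 erefl) => h; [left|right] => x ->.
move=> [Z [hZ ltZ]]; have [[W0 _ Z0E] [[a Z0a] _]] := hZ 0%N isT.
have [[W1 _ Z1E] [_ irr]] := hZ 1%N isT.
have [sub01 nsub] := ltZ 0%N isT.
have Z1s x : Z 1%N x -> x \in s by rewrite Z1E => -[/Xs].
have cover : Z 1%N `<=` [set a] `|` [set x | x \in [seq y <- s | y != a]].
  move=> x Z1x; have [->|xa] := eqVneq x a; first by left.
  by right; rewrite /= mem_filter xa Z1s.
have [Z1a|Z1n] := irr _ _ (closed1 a) (closed_seq closed1) cover.
- by apply: nsub => x /Z1a ->.
- by have := Z1n a (sub01 a Z0a); rewrite /= mem_filter eqxx.
Qed.

End KrullZero.

Section Grassmannian.
Variables (R : realType) (n : nat) (gamma : (n + n).-tuple {poly_(n + n) R}).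
Hypotheses (n_gt0 : (0 < n)%N) (gamma_rnc : rational_normal_curve gamma).
Hypothesis gamma_iso : forall s : R[i], isotropic_flag (osculating_flag gamma
  s).
Let K := R[i].
Implicit Types (A C : 'M[K]_(n, n + n)) (H : LG R n) (v w : 'rV[K]_(n + n)).

Local Notation T := (coord_mx gamma).
Local Notation b := (@invariant_coef R n (pairing_constant gamma)^-1).

Lemma row_spaceE A v : (v \in row_space A) = (v <= A)%MS.
Proof.
apply/idP/idP => [/(@coord_span _ _ _ (in_tuple _)) ->|/submxP[x ->]].
  apply: summx_sub => i _; apply: scalemx_sub.
  have : [seq row i A | i <- enum 'I_n]`_i \in [seq row i A | i <- enum 'I_n] by
    exact: mem_nth.
  by case/mapP=> j _ ->; exact: row_sub.
rewrite mulmx_sum_row; apply: memv_suml => i _; apply: memvZ; apply: memv_span.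
by apply: map_f; rewrite mem_enum.
Qed.

Lemma isotropic_mx d (A : 'M[K]_(d, n + n)) :
  (forall u v, (u <= A)%MS -> (v <= A)%MS -> sympl u v = 0) <->
  A *m sympl_mx R n *m A^T = 0.
Proof.
split=> [iso|iso u v /submxP[x ->] /submxP[y ->]]; last first.
  by rewrite symplE trmx_mul !mulmxA -2!(mulmxA x) iso mulmx0 mul0mx mxE.
apply/matrixP => i j; rewrite [RHS]mxE -(iso (row i A) (row j A)) ?row_sub //.
by rewrite symplE -row_mul [LHS]mxE [RHS]mxE; apply: eq_bigr => l _;
  rewrite !mxE.
Qed.

Lemma sympl_mx_unit : sympl_mx R n \in unitmx.
Proof. by apply: form_mx_unit; exact: sympl_coef_neq0. Qed.

Lemma rank_sympl_perp d (A : 'M[K]_(d, n + n)) :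
  \rank (kermx (sympl_mx R n *m A^T)) = (n + n - \rank A)%N.
Proof.
rewrite mxrank_ker -[in RHS]mxrank_tr -[X in (_ - X)%N]mxrank_tr trmx_mul trmxK.
rewrite mxrankMfree ?mxrank_tr // row_free_unit unitmx_tr.
exact: sympl_mx_unit.
Qed.

Lemma sub_sympl_perp d d' (A : 'M[K]_(d, n + n)) (B : 'M[K]_(d', n + n)) :
  (B <= kermx (sympl_mx R n *m A^T))%MS = (B *m sympl_mx R n *m A^T == 0).
Proof. by rewrite -mulmxA; exact: sub_kermx. Qed.

(** By [lagrangian_perp] the space is its own perpendicular, so its dimension [d] satisfies d = 2n -
    d. *)
Lemma lagrangian_row_space (F : {vspace 'rV[K]_(n + n)}) : lagrangian F ->
  exists A : 'M[K]_(n, n + n), [/\ row_free A, A *m sympl_mx R n *m A^T = 0 &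
    forall v, (v \in F) = (v <= A)%MS].
Proof.
move=> lagF; have [isoF _] := lagF.
have [d [A [fA FA]]] : exists d (A : 'M[K]_(d, n + n)), row_free A /\
    forall v, (v \in F) = (v <= A)%MS.
  pose A : 'M[K]_(\dim F, n + n) := \matrix_i (vbasis F)`_i.
  have sumA (x : 'rV[K]_(\dim F)) : x *m A = \sum_i x 0 i *: (vbasis F)`_i.
    by rewrite mulmx_sum_row; apply: eq_bigr => i _; rewrite rowK.
  exists (\dim F), A; split.
    rewrite -kermx_eq0; apply/rowV0P => x /sub_kermxP; rewrite sumA => x0.
    have /andP[_ /freeP fX] := vbasisP F.
    by apply/rowP => i; rewrite mxE (fX (fun i => x 0 i)).
  move=> v; apply/idP/submxP => [/coord_vbasis ->|[x ->]].
    exists (\row_i coord (vbasis F) i v); rewrite sumA.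
    by apply: eq_bigr => i _; rewrite mxE.
  rewrite sumA; apply: memv_suml => i _; apply: memvZ; apply: vbasis_mem.
  by apply: mem_nth; rewrite size_tuple.
have isoA : A *m sympl_mx R n *m A^T = 0.
  by apply/isotropic_mx => u v; rewrite -!FA; exact: isoF.
have rA : \rank A = d by apply/eqP.
have dn : d = n.
  have le1 : (d <= n + n - d)%N.
    by rewrite -{1}rA -{2}rA -rank_sympl_perp mxrankS // sub_sympl_perp isoA.
  have le2 : (n + n - d <= d)%N.
    rewrite -{1}rA -{2}rA -rank_sympl_perp mxrankS //; apply/rV_subP => v.
    rewrite sub_sympl_perp -FA => /eqP vA; apply: lagrangian_perp => // u.
    rewrite FA => /submxP[x ->]; rewrite sympl_skew symplE trmx_mul mulmxA vA.
    by rewrite mul0mx mxE oppr0.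
  lia.
by subst d; exists A.
Qed.

Lemma row_space_lagrangian A : row_free A -> A *m sympl_mx R n *m A^T = 0 ->
  lagrangian (row_space A).
Proof.
move=> fA isoA; split=> [u v|F isoF AF].
  by rewrite !row_spaceE; apply: (isotropic_mx A).2.
apply/eqP; rewrite eqEsubv AF andbT; apply/subvP => v vF; rewrite row_spaceE.
have rA : \rank A = n by apply/eqP.
have Ak : (A <= kermx (sympl_mx R n *m A^T))%MS by rewrite sub_sympl_perp isoA.
have := (mxrank_leqif_eq Ak).2; rewrite rank_sympl_perp rA addnK eqxx =>
  /esym/andP[_ kA].
apply: submx_trans kA; rewrite sub_sympl_perp; apply/eqP/rowP => j;
  rewrite [RHS]mxE.
have := isoF v (row j A) vF; rewrite symplE => <-; last first.
  by apply: (subvP AF); rewrite row_spaceE row_sub.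
by rewrite [LHS]mxE [RHS]mxE; apply: eq_bigr => l _; rewrite !mxE.
Qed.

Definition lg_matrix H C : Prop :=
  lagrangian_mx b C /\ forall v, (v \in lg_space H) = (v *m T <= C)%MS.

Let unitT : T \in unitmx. Proof. exact: coord_mx_unit. Qed.

Lemma coord_isotropic A :
  (A *m T) *m form_mx b *m (A *m T)^T = A *m sympl_mx R n *m A^T.
Proof.
rewrite -(coord_mx_form n_gt0 gamma_rnc gamma_iso) trmx_mul !mulmxA //.
Qed.

Lemma lg_lagrangian H : lagrangian H.
Proof. by case: H => F hF; apply/asboolP. Qed.

Lemma lg_matrix_row_space H A : row_space A = H -> lg_matrix H (A *m T).
Proof.
move=> AH; have [B [fB isoB HB]] := lagrangian_row_space (lg_lagrangian H).
have AB : (A :=: B)%MS.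
  by apply/eqmxP/andP; split; apply/rV_subP => v; rewrite -HB -AH row_spaceE.
have fA : row_free A by rewrite /row_free AB; exact: fB.
split=> [|v]; last first.
  by rewrite -AH row_spaceE submxMfree // row_free_unit.
split; first by rewrite /row_free mxrankMfree // row_free_unit.
rewrite coord_isotropic; apply/isotropic_mx => u v uA vA.
by have [isoH _] := lg_lagrangian H; apply: isoH; rewrite -AH row_spaceE.
Qed.

Lemma lg_matrix_exists H : exists C, lg_matrix H C.
Proof.
have [A [_ _ HA]] := lagrangian_row_space (lg_lagrangian H).
exists (A *m T); apply: lg_matrix_row_space.
by apply/vspaceP => v; rewrite row_spaceE HA.
Qed.

Lemma lg_of_matrix C : lagrangian_mx b C -> exists H, lg_matrix H C.
Proof.
move=> [fC isoC]; pose A := C *m invmx T.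
have CE : C = A *m T by rewrite mulmxKV.
have fA : row_free A by rewrite /row_free mxrankMfree // row_free_unit
  unitmx_inv.
have lagA : lagrangian (row_space A).
  by apply: row_space_lagrangian; rewrite // -coord_isotropic -CE.
have lagA' : `[< lagrangian (row_space A) >] by apply/asboolP.
by exists (MkLG lagA'); rewrite CE; apply: lg_matrix_row_space.
Qed.

Lemma lg_matrix_inj H H' C g : g \in unitmx ->
  lg_matrix H (g *m C) -> lg_matrix H' C -> H = H'.
Proof.
move=> ug [_ hH] [_ hH']; apply: val_inj; apply/vspaceP => v; rewrite hH hH'.
have gC : (g *m C :=: C)%MS by apply: eqmxMfull; rewrite row_full_unit.
by rewrite gC.
Qed.

(** ** Zariski closed sets *)

Lemma polyfun_mpoly (f : 'M[K]_(n, n + n) -> K) : polyfun (@mxentry K n (n + n))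
  f ->
  exists p : mpoly.mpoly (n * (n + n)) K, forall A,
    mpoly.meval (fun k => mxvec A 0 k) p = f A.
Proof.
elim=> {f}[f [i [j ->]]|c|f g _ [p hp] _ [q hq]|f g _ [p hp] _ [q hq]].
- by exists (mpoly.mpolyX K (mpoly.mnm1 (mxvec_index i j))) => A;
  rewrite mpoly.mevalXU mxvecE.
- by exists (mpoly.mpolyC _ c) => A; rewrite mpoly.mevalC.
- by exists (p + q) => A; rewrite rmorphD /= hp hq.
- by exists (p * q) => A; rewrite rmorphM /= hp hq.
Qed.

Lemma zariski_closed_polyfun (Z : set (LG R n)) (I : Type) (f : I -> 'M[K]_(n, n
  + n) -> K) :
  (forall i, polyfun (@mxentry K n (n + n)) (f i)) ->
  (forall A H, row_space A = H -> Z H <-> forall i, f i A = 0) -> closed Z.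
Proof.
move=> pf Zf; rewrite -[Z]setCK; apply: open_closedC;
  change (zariski_open (~` Z)%classic).
rewrite /zariski_open setCK.
have /boolp.choice[p hp] := fun i => polyfun_mpoly (pf i).
exists (fun q => exists i, q = p i) => A H AH; rewrite (Zf A H AH);
  split=> [h q [i ->]|h i].
  by rewrite hp.
by rewrite -hp; apply: h; exists i.
Qed.

(** Containment in a fixed subspace is polynomial in the rows, and containment between Lagrangian
    subspaces is equality. *)
Lemma closed_lg1 H0 : closed [set H0]%classic.
Proof.
have [B [_ _ HB]] := lagrangian_row_space (lg_lagrangian H0).
apply: (@zariski_closed_polyfun _ ('I_n * 'I_(n + n))
  (fun ij A => (A *m cokermx B) ij.1 ij.2)) => [[i j]|A H AH].
  by apply: polyfun_mulmx => ? ?; [exact: polyfun_mxentry | exact: polyfun_cst].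
have -> : (forall ij : 'I_n * 'I_(n + n), (A *m cokermx B) ij.1 ij.2 = 0) <-> (A
  <= B)%MS.
  rewrite submxE; split=> [h|/eqP -> ij]; last by rewrite mxE.
  by apply/eqP/matrixP => i j; rewrite [RHS]mxE; exact: (h (i, j)).
split=> [/= HH0|AB].
  by apply/rV_subP => v; rewrite -HB -HH0 -AH row_spaceE.
apply/esym/val_inj; have [_ maxH] := lg_lagrangian H; apply: maxH.
  by have [] := lg_lagrangian H0.
by apply/subvP => v; rewrite -AH row_spaceE HB => /submx_trans; apply.
Qed.

End Grassmannian.

(** * Schubert conditions in polynomial coordinates *)

Section Schubert.
Variables (R : realType) (n : nat) (gamma : (n + n).-tuple {poly_(n + n) R}).
Hypotheses (n_gt0 : (0 < n)%N) (gamma_rnc : rational_normal_curve gamma).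
Hypothesis gamma_iso : forall s : R[i], isotropic_flag (osculating_flag gamma
  s).
Let K := R[i].
Implicit Types (A C : 'M[K]_(n, n + n)) (H : LG R n) (v w : 'rV[K]_(n + n)).

Local Notation T := (coord_mx gamma).
Local Notation b := (@invariant_coef R n (pairing_constant gamma)^-1).
Local Notation F := (osculating_flag gamma).

Let unitT : T \in unitmx. Proof. exact: coord_mx_unit. Qed.

Let b_neq0 j : b j != 0.
Proof. by apply: invariant_coef_neq0; rewrite invr_eq0 pairing_constant_neq0.
  Qed.

Let b_rev j : b (rev_ord j) = - b j. Proof. exact: invariant_coef_rev. Qed.

Lemma simple_schubertP H C s : lg_matrix gamma H C ->
  simple_schubert (F s) H <-> wronskian C s = 0.
Proof.
move=> [[fC _] HC]; rewrite (wronskian_eq0P s fC).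
have memF v : (v \in F s n) <-> vanishes n (rVpoly (v *m T)) s.
  by rewrite (mem_osculating_flag gamma_iso) ?addnK // leqnn leq_addr.
split=> [HF|[w [w0 wC van]]].
  have := memv_pick (H :&: F s n)%VS; rewrite memv_cap HC => /andP[vC /memF
    van].
  exists (vpick (H :&: F s n)%VS *m T); split=> //.
  by rewrite mulmx_free_eq0 ?vpick0 // row_free_unit.
have wE : w = w *m invmx T *m T by rewrite mulmxKV.
apply: contra_neq w0 => HF0.
have : w *m invmx T \in (H :&: F s n)%VS by rewrite memv_cap HC -wE wC;
  apply/memF; rewrite -wE.
by rewrite HF0 memv0 => /eqP w0; rewrite wE w0 mul0mx.
Qed.

Lemma vanishes0P t w : (t <= n + n)%N ->
  vanishes t (rVpoly w) 0 <-> forall j : 'I_(n + n), (j < t)%N -> w 0 j = 0.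
Proof.
move=> tn; split=> [van j jt|w0 k kt].
  have /eqP := van j jt; rewrite horner0_derivn coef_rVpoly_ord mulrn_eq0.
  by rewrite -leqn0 leqNgt fact_gt0 => /eqP.
have kn := leq_trans kt tn.
by rewrite horner0_derivn -[k]/(val (Ordinal kn)) coef_rVpoly_ord w0 ?mul0rn.
Qed.

(** In coefficients, step n + i of the flag at 0 consists of the vectors whose first n - i entries
    vanish. A jump at n + k + 1 is thus a vector starting at index n - k - 1, which is [lo k]. *)
Lemma flag_jumpP H C (k : 'I_n) : lg_matrix gamma H C ->
  ((H :&: F 0%R (n + k.+1))%VS != (H :&: F 0%R (n + k.+1).-1)%VS) = (k \in
    low_positions C).
Proof.
move=> [_ HC]; have kn := ltn_ord k.
have memF v i : (i <= n)%N ->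
    (v \in F 0%R (n + i)) <-> forall j : 'I_(n + n), (j < n - i)%N -> (v *m T) 0
      j = 0.
  move=> i_n; rewrite (mem_osculating_flag gamma_iso) ?leq_addr ?leq_add2l //
    subnDl.
  by rewrite vanishes0P // (leq_trans (leq_subr _ _)) // leq_addr.
have -> : (n + k.+1).-1 = (n + k)%N by rewrite addnS.
have [_ subF _ _] := gamma_iso 0.
have le : (H :&: F 0%R (n + k) <= H :&: F 0%R (n + k.+1))%VS.
  by apply: capvS; rewrite // addnS subF // ltn_add2l.
apply/idP/low_positionsP => [ne|[w [wC w0 wk]]].
  have [v vH vF] : exists2 v, v \in (H :&: F 0%R (n + k.+1))%VS & v \notin F 0%R
    (n + k).
    have : ~~ (H :&: F 0%R (n + k.+1) <= F 0%R (n + k))%VS.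
      apply: contra ne => sub; rewrite eqEsubv le andbT.
      by rewrite subv_cap capvSl sub.
    by case/subvPn => v; exists v.
  move: vH; rewrite memv_cap HC => /andP[vC /(memF _ _ kn) v0].
  exists (v *m T); split=> //; apply: contraNneq vF => vk.
  apply/(memF _ _ (ltnW kn)) => j jk; have [jk'|jk'] := ltnP j (n - k.+1);
    first exact: v0.
  by have -> : j = lo k by apply: val_inj; rewrite /=; lia.
have wE : w = w *m invmx T *m T by rewrite mulmxKV.
apply: contraNneq wk => eqF; apply/eqP; rewrite wE.
have : w *m invmx T \in (H :&: F 0%R (n + k.+1))%VS.
  by rewrite memv_cap HC -wE wC; apply/(memF _ _ kn) => j jk; rewrite -wE w0.
rewrite eqF memv_cap => /andP[_ /(memF _ _ (ltnW kn))]; apply.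
by rewrite lo_val; lia.
Qed.

Definition partition_set (lam : seq nat) : {set 'I_n} := [set k : 'I_n | k.+1
  \in lam].

Lemma weight_partition_set lam : strict_partition n lam ->
  weight (partition_set lam) = sumn lam.
Proof.
move=> /andP[lam_sorted /allP lam_n].
have u_lam : uniq lam.
  by apply: sorted_uniq lam_sorted; [move=> x y z; exact: (rev_trans ltn_trans)
    | exact: ltnn].
have : perm_eq [seq (val k).+1 | k <- enum (partition_set lam)] lam.
  apply: uniq_perm => //.
    by rewrite map_inj_uniq ?enum_uniq // => k l [/val_inj].
  move=> i; apply/mapP/idP => [[k]|il]; first by rewrite mem_enum inE => kl ->.
  have /andP[i0 i_n] := lam_n i il.
  have i_n' : (i.-1 < n)%N by rewrite prednK.
  exists (Ordinal i_n') => /=; last by rewrite prednK.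
  by rewrite mem_enum inE /= prednK.
move/perm_sumn <-; rewrite sumnE big_map /weight big_enum_cond /=.
by apply: eq_bigl => k; rewrite andbT.
Qed.

Lemma schubert_cellP H C lam : strict_partition n lam -> lg_matrix gamma H C ->
  schubert_cell (F 0) lam H <-> low_positions C = partition_set lam.
Proof.
move=> /andP[_ /allP lam_n] HC; split=> [cell|low j /andP[nj j2n]].
  apply/setP => k; rewrite -(flag_jumpP k HC) cell; last first.
    by have := ltn_ord k; lia.
  by rewrite inE mem_map // => x y /addnI.
have kn : (j - n.+1 < n)%N by lia.
have jE : j = (n + (Ordinal kn).+1)%N by rewrite /=; lia.
rewrite jE (flag_jumpP _ HC) low inE mem_map // => x y /addnI //.
Qed.

(** An upper bound for the closure is enough: the cell satisfies the coarse condition, and that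
    condition is closed. *)
Lemma schubert_variety_sub lam H C : strict_partition n lam -> lg_matrix gamma H
  C ->
  schubert_variety (F 0) lam H -> in_schubert C (partition_set lam).
Proof.
move=> lam_SP HC; set mu := partition_set lam.
pose Z : set (LG R n) := fun H => forall C, lg_matrix gamma H C -> in_schubert C
  mu.
suff closedZ : closed Z.
  have subZ : (schubert_cell (F 0) lam `<=` Z)%classic.
    move=> H' cell C' HC'; rewrite /mu -((schubert_cellP lam_SP HC').1 cell).
    exact: in_schubert_low.
  move=> /(closure_subset subZ); rewrite -((closure_id Z).1 closedZ).
  by apply.
apply: (@zariski_closed_polyfun _ _ Z _ (fun nu A =>
  ((nu != mu) && (weight mu <= weight nu)%N)%:R * minor (column nu) (A *m T))).
  move=> nu; apply: polyfun_mul; first exact: polyfun_cst.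
  apply: polyfun_comp (@polyfun_minor K n (n + n) (column nu)) => f [i [j ->]].
  by apply: polyfun_mulmx => ? ?; [exact: polyfun_mxentry | exact: polyfun_cst].
move=> A H' AH; have HA := lg_matrix_row_space n_gt0 gamma_rnc gamma_iso AH.
split=> [ZH nu|h C' HC' nu ne le].
  by case: andP => [[ne le]|_]; rewrite ?mul0r // mul1r (ZH _ HA).
have [g CE] : exists g, C' = g *m (A *m T).
  apply/submxP; apply/rV_subP => v vC'.
  have vE : v = v *m invmx T *m T by rewrite mulmxKV.
  by rewrite vE -HA.2 HC'.2 -vE.
by rewrite CE minor_semi_invariant; have := h nu; rewrite ne le mul1r => ->;
  rewrite mulr0.
Qed.

Lemma real_point_matrix H C : lg_matrix gamma H C -> real_point H ->
  forall w, (w <= C)%MS -> (map_mx (@conjc R) w <= C)%MS.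
Proof.
move=> [_ HC] realH w wC; have wE : w = w *m invmx T *m T by rewrite mulmxKV.
have conjT : map_mx (@conjc R) T = T.
  apply/matrixP => i j; rewrite mxE /coord_mx !mxE rmorph_sum;
    apply: eq_bigr => l _.
  rewrite rmorphM /= !mxE; congr (_ * _); last exact: conjc_real.
  rewrite raddfMn /=; congr (_ *+ _); rewrite /sympl_coef.
  by case: ifP => _; apply/eqP; rewrite eq_complex /= !oppr0 !eqxx.
have : w *m invmx T \in lg_space H by rewrite HC -wE.
rewrite -realH HC -{2}conjT -map_mxM -wE //.
Qed.

End Schubert.

Local Open Scope classical_set_scope.
Local Open Scope ring_scope.
Local Open Scope complex_scope.

Theorem theorem4p2 (R : realType) (n : nat)
    (gamma : (n + n).-tuple {poly_(n + n) R})
    (gamma_rnc : rational_normal_curve gamma)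
    (gamma_iso : forall s : R[i], isotropic_flag (osculating_flag gamma s))
    (lam : seq nat) (lam_SP : strict_partition n lam)
    (r : nat) (lam_r : sumn lam = r) (r_gt1 : (1 < r)%N) :
  exists s : 'I_r -> R,
    let X : set (LG R n) :=
      schubert_variety (osculating_flag gamma 0) lam `&`
      \bigcap_(i in [set: 'I_r])
        simple_schubert (osculating_flag gamma (s i)%:C) in
    has_dimension X 0 /\ (forall H, X H -> ~ real_point H).
Proof.
have n_gt0 : (0 < n)%N.
  have pos l : strict_partition n l -> (0 < sumn l)%N -> (0 < n)%N.
    by case: l => // k l /andP[_ /= /andP[/andP[k0 kn] _]] _;
      exact: leq_trans kn.
  by apply: pos lam_SP _; rewrite lam_r ltnW.
pose c := (pairing_constant gamma)^-1; pose b := @invariant_coef R n c.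
have c0 : c != 0 by rewrite invr_eq0 pairing_constant_neq0.
have b_neq0 := @invariant_coef_neq0 R n c c0.
have b_rev := @invariant_coef_rev R n c.
have wl : weight (partition_set n lam) = r by rewrite weight_partition_set.
have [ss [sr us s0 gs]] := @exists_generic_points R n b b_neq0 r.
exists (fun i => nth 0 ss i) => X.
have memX H C : lg_matrix gamma H C -> X H ->
    in_schubert C (partition_set n lam) /\ on_hyperplanes ss C.
  move=> HC [varH YH]; split; first exact: schubert_variety_sub HC varH.
  move=> s /(nthP 0)[i i_ss <-]; rewrite sr in i_ss.
  exact/(simple_schubertP gamma_rnc gamma_iso _ HC)/(YH (Ordinal i_ss)).
have weight_ss : weight (partition_set n lam) = size ss by rewrite wl sr.
have low H C : lg_matrix gamma H C -> X H -> low_positions C = partition_set n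
  lam.
  move=> HC XH; have [inC onC] := memX H C HC XH; have [[fC isoC] _] := HC.
  apply: (in_schubert_neq0 b_neq0 fC isoC inC).
  exact: generic_points_minor gs weight_ss HC.1 inC onC.
split; last first.
  move=> H XH realH; have [C HC] := lg_matrix_exists n_gt0 gamma_rnc gamma_iso
    H.
  have [_ onC] := memX H C HC XH.
  apply: (no_real_point c0 HC.1 (low H C HC XH) _ weight_ss us s0 onC).
    by rewrite wl.
  exact: real_point_matrix HC realH.
have ss_gt0 : (0 < size ss)%N by rewrite sr ltnW.
have [C0 [lagC0 inC0 onC0]] := generic_points_nonempty b_neq0 b_rev gs weight_ss
  ss_gt0.
have [H0 H0C0] := lg_of_matrix n_gt0 gamma_rnc gamma_iso lagC0.
(* The solution satisfies only the coarse equations, but genericity of the points puts it in the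
   open cell, hence in the closure. *)
have XH0 : X H0.
  split=> [|i _].
    apply: subset_closure; apply/(schubert_cellP n_gt0 gamma_rnc gamma_iso
      lam_SP H0C0).
    have [fC0 isoC0] := lagC0; apply: (in_schubert_neq0 b_neq0 fC0 isoC0 inC0).
    exact: generic_points_minor gs weight_ss lagC0 inC0 onC0.
  apply/(simple_schubertP gamma_rnc gamma_iso _ H0C0)/onC0.
  by rewrite mem_nth // sr.
have [Bs hBs] := generic_points_finite b_neq0 gs weight_ss.
(* Matrices of [Bs] that are not Lagrangian are sent to the arbitrary point [H0]. *)
have /boolp.choice[h hh] B : exists H, lagrangian_mx b B -> lg_matrix gamma H B.
  have [lagB|] := EM (lagrangian_mx b B); last by exists H0.
  by have [H HB] := lg_of_matrix n_gt0 gamma_rnc gamma_iso lagB; exists H.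
apply: (@finite_has_dimension0 _ X [seq h B | B <- Bs]);
  first exact: closed_lg1.
  by exists H0.
move=> H XH; have [C HC] := lg_matrix_exists n_gt0 gamma_rnc gamma_iso H.
have [inC onC] := memX H C HC XH.
have [B BBs [g ug CB]] := hBs C HC.1 inC onC.
have lagB : lagrangian_mx b B.
  have BC : B = invmx g *m C by rewrite CB mulKmx.
  have [fC isoC] := HC.1; split.
    by rewrite /row_free BC eqmxMfull // row_full_unit unitmx_inv.
  by rewrite BC trmx_mul !mulmxA -2!(mulmxA (invmx g)) isoC mulmx0 mul0mx.
apply/mapP; exists B => //.
by apply: lg_matrix_inj ug _ (hh B lagB); rewrite -CB.
Qed.
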